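(* Let $(\alpha,\tilde\beta)$ and $(\alpha',\tilde\beta')$ in $\mathfrak{k}_{\mathbb{R}}^\vee\times\mathfrak{k}^\vee$ be generic, i.e. regular values of $\widetilde{\mu}_{\mathrm{K}}=(\widetilde{\mu}_{\mathbb{R},\mathrm{K}},\widetilde{\mu}_{\mathbb{C},\mathrm{K}})$. Then $\widetilde{\mathfrak{M}}^\tau_u(\alpha,\tilde\beta)$ is homeomorphic to $\widetilde{\mathfrak{M}}^\tau_u(\alpha',\tilde\beta')$.
   Context: Fix $\tau$ in the upper half-plane, $\Gamma=\mathbb{Z}+\mathbb{Z}\tau$, $q=e^{2\pi i\tau}$. Let $\vartheta(x)=(t^{1/2}-t^{-1/2})\prod_{m>0}(1-q^mt)(1-q^mt^{-1})$ with $t=e^{2\pi ix}$, and $\widetilde{X}_\vartheta=\{(z,w,x)\in\mathbb{C}^3: zw=\vartheta(x)\}$. Let $\mathfrak{t},\mathfrak{a}$ be complex vector spaces of dimensions $n,d$ with lattices $\mathfrak{t}_{\mathbb{Z}},\mathfrak{a}_{\mathbb{Z}}$, $e_1,\dots,e_n$ a $\mathbb{Z}$-basis of $\mathfrak{t}_{\mathbb{Z}}$ with dual basis $e_i^\vee$, and $u=\{u_1,\dots,u_n\}\subset\mathfrak{a}_{\mathbb{Z}}$ primitive vectors spanning $\mathfrak{a}_{\mathbb{Z}}$ over $\mathbb{Z}$. Let $\pi:\mathfrak{t}\to\mathfrak{a}$, $\pi(e_i)=u_i$, $\mathfrak{k}=\ker\pi$ (dimension $k=n-d$), $\iota:\mathfrak{k}\to\mathfrak{t}$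 the inclusion and $\iota^\vee:\mathfrak{t}^\vee\to\mathfrak{k}^\vee$ its dual. Let $\mathrm{T}=\mathfrak{t}/\mathfrak{t}_{\mathbb{Z}}\cong(\mathbb{C}^\times)^n$, $\mathrm{A}=\mathfrak{a}/\mathfrak{a}_{\mathbb{Z}}$, $\mathrm{K}=\ker(\mathrm{T}\to\mathrm{A})$, with $\mathrm{K}_{\mathbb{R}}$ its maximal compact subtorus. $\mathrm{T}$ acts on $\widetilde{X}_\vartheta^n$ by $t\cdot(z_i,w_i,x_i)_i=(t_iz_i,t_i^{-1}w_i,x_i)_i$. Equip $\widetilde{X}_\vartheta^n$ with the holomorphic symplectic form $\sum_i\mathrm{Res}\frac{dz_i\wedge dw_i\wedge dx_i}{z_iw_i-\vartheta(x_i)}$ and the Kähler form $\frac{\sqrt{-1}}{2}\partial\bar\partial\sum_i\left(|z_i|^2+e^{-2\pi(\mathrm{Im}\,x_i)^2/\mathrm{Im}\,\tau}|w_i|^2+\frac{|x_i|^2}{\mathrm{Im}\,\tau}\right)$. The moment maps for $\mathrm{K}$ and $\mathrm{K}_{\mathbb{R}}$ are $\widetilde{\mu}_{\mathbb{C},\mathrm{K}}(z,w,x)=\sum_i x_i\,\iota^\vee e_i^\vee\in\mathfrak{k}^\vee$ and $\widetilde{\mu}_{\mathbb{R},\mathrm{K}}(z,w,x)=\frac12\sum_i\left(|z_i|^2-e^{-2\pi(\mathrm{Im}\,x_i)^2/\mathrm{Im}\,\tau}|w_i|^2\right)\iota^\vee e_i^\vee\in\mathfrak{k}^\vee_{\mathbb{R}}$.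 For $(\alpha,\tilde\beta)\in\mathfrak{k}_{\mathbb{R}}^\vee\times\mathfrak{k}^\vee$ define $\widetilde{\mathfrak{M}}^\tau_u(\alpha,\tilde\beta)=(\widetilde{\mu}_{\mathbb{R},\mathrm{K}},\widetilde{\mu}_{\mathbb{C},\mathrm{K}})^{-1}(\alpha,\tilde\beta)/\mathrm{K}_{\mathbb{R}}$. *)

(* Defs.v *)
From mathcomp Require Import all_boot all_order all_algebra.
From mathcomp Require Import all_classical all_reals all_analysis.
From mathcomp Require Import complex.
Set Implicit Arguments. Unset Strict Implicit. Unset Printing Implicit Defensive.
Import Order.TTheory GRing.Theory Num.Theory.
Import numFieldNormedType.Exports.
Local Open Scope ring_scope.
Local Open Scope classical_set_scope.
Local Open Scope complex_scope.

Section Hypertoric.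
Variable R : realType.

Definition cexp (a b : R) : R[i] := (expR a * cos b) +i* (expR a * sin b).

Definition e2pi (c : R) (y : R[i]) : R[i] :=
  cexp (- (2 * pi * c) * complex.Im y) (2 * pi * c * complex.Re y).

(* Partial products of the theta function
   theta(x) = (t^{1/2} - t^{-1/2}) prod_{m>0} (1 - q^m t)(1 - q^m t^{-1}),
   t = e^{2 pi i x}, q = e^{2 pi i tau}. *)
Definition theta_partial (tau x : R[i]) (N : nat) : R[i] :=
  let q := e2pi 1 tau in
  let t := e2pi 1 x in
  let ti := e2pi (-1) x in
  (e2pi (1/2) x - e2pi (-1/2) x) *
  \prod_(1 <= m < N.+1) ((1 - q ^+ m * t) * (1 - q ^+ m * ti)).

Definition theta (tau x : R[i]) : R[i] :=
  limn ((fun N => complex.Re (theta_partial tau x N)) : R^nat) +i*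
  limn ((fun N => complex.Im (theta_partial tau x N)) : R^nat).

(* Points of C^{3n} in real coordinates: a 6 x n real matrix whose rows are
   complex.Re z, complex.Im z, complex.Re w, complex.Im w, complex.Re x, complex.Im x. *)
Definition r0 : 'I_6 := @Ordinal 6 0 isT.
Definition r1 : 'I_6 := @Ordinal 6 1 isT.
Definition r2 : 'I_6 := @Ordinal 6 2 isT.
Definition r3 : 'I_6 := @Ordinal 6 3 isT.
Definition r4 : 'I_6 := @Ordinal 6 4 isT.
Definition r5 : 'I_6 := @Ordinal 6 5 isT.

Definition zc n (p : 'M[R]_(6, n)) i : R[i] := p r0 i +i* p r1 i.
Definition wc n (p : 'M[R]_(6, n)) i : R[i] := p r2 i +i* p r3 i.
Definition xc n (p : 'M[R]_(6, n)) i : R[i] := p r4 i +i* p r5 i.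

Definition pt n (z w x : 'I_n -> R[i]) : 'M[R]_(6, n) :=
  \matrix_(r, i)
    (if r == r0 then complex.Re (z i) else if r == r1 then complex.Im (z i)
     else if r == r2 then complex.Re (w i) else if r == r3 then complex.Im (w i)
     else if r == r4 then complex.Re (x i) else complex.Im (x i)).

(* Equations of (X~_theta)^n inside C^{3n}: z_i w_i - theta(x_i) = 0,
   as a map to 2 x n real matrices (real and imaginary parts). *)
Definition eqX (tau : R[i]) n (p : 'M[R]_(6, n)) : 'M[R]_(2, n) :=
  \matrix_(r, i)
    (let v := zc p i * wc p i - theta tau (xc p i) in
     if r == 0 then complex.Re v else complex.Im v).

(* The hyperkaehler moment map mu_K = (mu_R, mu_C) with values in
   k_R^vee x k^vee.  We use the coordinates given by a real basis
   (columns of B : 'M_(n, k)) of k_R = ker pi; then iota^vee e_i^vee is the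
   i-th row of B.  Row 0 : mu_R, rows 1, 2 : real/imaginary parts of mu_C. *)
Definition sqn (v : R[i]) : R := complex.Re v ^+ 2 + complex.Im v ^+ 2.

Definition muK (tau : R[i]) n k (B : 'M[R]_(n, k)) (p : 'M[R]_(6, n))
    : 'M[R]_(3, k) :=
  \matrix_(r, j)
    (if r == 0 then
       2^-1 * \sum_(i < n) (sqn (zc p i)
          - expR (- (2 * pi) * (complex.Im (xc p i)) ^+ 2 / complex.Im tau) * sqn (wc p i))
          * B i j
     else if r == 1 then \sum_(i < n) complex.Re (xc p i) * B i j
     else \sum_(i < n) complex.Im (xc p i) * B i j).

Definition level_val k (alpha : 'rV[R]_k) (beta : 'rV[R[i]]_k) : 'M[R]_(3, k) :=
  \matrix_(r, j)
    (if r == 0 then alpha 0 j else if r == 1 then complex.Re (beta 0 j)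
     else complex.Im (beta 0 j)).

Definition level (tau : R[i]) n k (B : 'M[R]_(n, k)) (c : 'M[R]_(3, k))
    (p : 'M[R]_(6, n)) : Prop :=
  eqX tau p = 0 /\ muK tau B p = c.

(* c is a regular value of mu_K restricted to the complex manifold
   X~^n = {eqX = 0} (whose tangent space at p is ker d(eqX)_p):
   at every point of the level set, d(mu_K)_p restricted to T_p X~^n is
   onto. *)
Definition regular_value (tau : R[i]) n k (B : 'M[R]_(n, k))
    (c : 'M[R]_(3, k)) : Prop :=
  forall p : 'M[R]_(6, n), level tau B c p ->
    differentiable (@eqX tau n) p /\ differentiable (muK tau B) p /\
        (forall v : 'M[R]_(3, k), exists h : 'M[R]_(6, n),
          'd (@eqX tau n) p h = 0 /\ 'd (muK tau B) p h = v).

(* K_R = maximal compact subtorus of K = ker(T -> A):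
   t = (e^{2 pi i xi_j})_j with xi real and sum_j xi_j u_j in a_Z = Z^d. *)
Definition in_KR n d (u : 'M[int]_(n, d)) (xi : 'rV[R]_n) : Prop :=
  forall j : 'I_d, exists m : int, \sum_(i < n) xi 0 i * (u i j)%:~R = m%:~R.

Definition actK n (xi : 'rV[R]_n) (p : 'M[R]_(6, n)) : 'M[R]_(6, n) :=
  pt (fun i => cexp 0 (2 * pi * xi 0 i) * zc p i)
     (fun i => cexp 0 (- (2 * pi * xi 0 i)) * wc p i)
     (fun i => xc p i).

Definition orbitK n d (u : 'M[int]_(n, d)) (p : 'M[R]_(6, n))
    : set 'M[R]_(6, n) :=
  [set q | exists xi, in_KR u xi /\ q = actK xi p].

Definition orbit_space (tau : R[i]) n d k (u : 'M[int]_(n, d))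
    (B : 'M[R]_(n, k)) (c : 'M[R]_(3, k)) : set (set 'M[R]_(6, n)) :=
  [set O | exists p, level tau B c p /\ O = orbitK u p].

Definition quot_open (tau : R[i]) n d k (u : 'M[int]_(n, d))
    (B : 'M[R]_(n, k)) (c : 'M[R]_(3, k)) (U : set (set 'M[R]_(6, n))) : Prop :=
  U `<=` orbit_space tau u B c /\
  exists V : set 'M[R]_(6, n), open V /\
    forall p, level tau B c p -> (U (orbitK u p) <-> V p).

Definition quot_homeomorphic (tau : R[i]) n d k (u : 'M[int]_(n, d))
    (B : 'M[R]_(n, k)) (c c' : 'M[R]_(3, k)) : Prop :=
  let Q := orbit_space tau u B c in
  let Q' := orbit_space tau u B c' in
  exists (f g : set 'M[R]_(6, n) -> set 'M[R]_(6, n)),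
    (forall O, Q O -> Q' (f O)) /\
    (forall O, Q' O -> Q (g O)) /\
    (forall O, Q O -> g (f O) = O) /\
    (forall O, Q' O -> f (g O) = O) /\
    (forall U, quot_open tau u B c' U ->
               quot_open tau u B c [set O | Q O /\ U (f O)]) /\
    (forall U, quot_open tau u B c U ->
               quot_open tau u B c' [set O | Q' O /\ U (g O)]).

Definition primitive_row n d (u : 'M[int]_(n, d)) (i : 'I_n) : Prop :=
  forall m : int, (forall j, (m %| u i j)%Z) -> m = 1 \/ m = -1.

Definition spans_lattice n d (u : 'M[int]_(n, d)) : Prop :=
  forall v : 'rV[int]_d, exists a : 'rV[int]_n, v = a *m u.

(* B : real basis of k_R = ker (pi : t_R -> a_R), pi(e_i) = u_i *)
Definition kernel_basis n d k (u : 'M[int]_(n, d)) (B : 'M[R]_(n, k)) : Prop :=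
  (map_mx (fun m : int => (m%:~R : R)) u)^T *m B = 0 /\ \rank B = (n - d)%N
  /\ k = (n - d)%N.

End Hypertoric.

(* Main.v *)
Require Import Defs.
From mathcomp Require Import all_boot all_order all_algebra.
From mathcomp Require Import all_classical all_reals all_analysis.
From mathcomp Require Import complex polyrcf.
From mathcomp Require Import ring lra.
Import Order.TTheory GRing.Theory Num.Theory.
Import numFieldNormedType.Exports.
Local Open Scope ring_scope.
Local Open Scope classical_set_scope.
Local Open Scope complex_scope.
Set Implicit Arguments. Unset Strict Implicit. Unset Printing Implicit Defensive.

(** The quotient of [X~_theta] by the circle is [R^3], via the real moment [m] and [x]
    (given [z w = theta x], the moment fixes [|z|] and [|w|]); the fixed points lie over
    [m = 0, theta x = 0].  Two kinds of K_R-equivariant homeomorphisms between level sets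
    suffice, and no flow of a vector field is needed.

    Shears.  The map [(m, x) |-> (m, x + h m)] of [R^3] lifts to an equivariant
    homeomorphism of [X~_theta]: keep the phase of [z] where [m > 0], that of [w] where
    [m < 0], and take the identity on [m = 0].  Applied to every factor it carries the
    level [(alpha, beta)] onto [(alpha, beta + h alpha)], for any complex [h].

    Vertical moves.  If no point over [beta] has a positive-dimensional stabiliser, every
    orbit of the complexified torus meets each level [(alpha, beta)] in exactly one
    K_R-orbit: the position is the minimum of a strictly convex function, and depends
    continuously on the point because its gradient is locally uniformly monotone.  Hence
    [alpha] can be changed arbitrarily.

    The zeros of [theta] lie in a countable set, so a regular value can be sheared to one
    with generic [beta], and alternating the two moves leads to a normal form
    [(0, i y)] that does not depend on the regular value. *)

(** * Convergence and non-vanishing of infinite products of complex numbers *)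

Section ComplexProduct.
Variable R : realType.
Local Notation nc := (@Normc.normc R).

Lemma normcE_sqn (z : R[i]) : nc z = Num.sqrt (sqn z).
Proof. by case: z. Qed.

Lemma sqn_ge0 (z : R[i]) : 0 <= sqn z.
Proof. by rewrite addr_ge0 ?sqr_ge0. Qed.

Lemma sqnM (z w : R[i]) : sqn (z * w) = sqn z * sqn w.
Proof. by case: z w => [a b] [c d]; rewrite /sqn /=; ring. Qed.

Lemma sqn_eq0 (z : R[i]) : (sqn z == 0) = (z == 0).
Proof. by case: z => a b; rewrite eq_complex /sqn /= paddr_eq0 ?sqr_ge0// !sqrf_eq0. Qed.

Lemma sqn_gt0 (z : R[i]) : (0 < sqn z) = (z != 0).
Proof. by rewrite lt_def sqn_ge0 andbT sqn_eq0. Qed.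

Lemma normc_ge0 (z : R[i]) : 0 <= nc z.
Proof. by rewrite normcE_sqn sqrtr_ge0. Qed.

Lemma normr_Re_le (z : R[i]) : `|complex.Re z| <= nc z.
Proof.
by case: z => a b /=; rewrite -(sqrtr_sqr a) ler_wsqrtr// lerDl sqr_ge0.
Qed.

Lemma normr_Im_le (z : R[i]) : `|complex.Im z| <= nc z.
Proof.
by case: z => a b /=; rewrite -(sqrtr_sqr b) ler_wsqrtr// lerDr sqr_ge0.
Qed.

Lemma normcD_le (z w : R[i]) : nc (z + w) <= nc z + nc w.
Proof. exact: (@le_normcD R z w). Qed.

Section InfiniteProduct.
Variables (A : R[i]) (f : nat -> R[i]) (K r : R).
Hypotheses (K0 : 0 <= K) (r0 : 0 < r) (r1 : r < 1).
Hypothesis fK : forall m, nc (f m - 1) <= K * r ^+ m.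

Let P N := A * \prod_(1 <= m < N.+1) f m.

Let PS N : P N.+1 = P N * f N.+1.
Proof. by rewrite /P big_nat_recr //= mulrA. Qed.

Let r_norm : `|r| < 1. Proof. by rewrite gtr0_norm. Qed.

Let P_bounded N : nc (P N) <= nc A * expR (K / (1 - r)).
Proof.
(* From [|f m| <= 1 + K r^m <= exp (K r^m)]. The series runs to [N.+1] so that its last exponent is
   [N], the index of the last factor of [P N]; the exponent [0] only adds a nonnegative term. *)
apply: (@le_trans _ _ (nc A * expR (series (geometric K r) N.+1))).
  elim: N => [|N IH].
    rewrite /P big_geq// mulr1 ler_peMr ?normc_ge0//.
    rewrite -[leLHS](@expR0 R) ler_expR seriesEnat sumr_ge0// => i _ /=.
    by rewrite mulr_ge0// exprn_ge0// ltW.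
  rewrite PS Normc.normcM seriesSr/= expRD mulrA.
  apply: ler_pM; rewrite ?normc_ge0//.
  apply: (le_trans _ (expR_ge1Dx _)).
  have -> : f N.+1 = 1 + (f N.+1 - 1) by rewrite addrC subrK.
  by apply: (le_trans (normcD_le _ _)); rewrite Normc.normc1 lerD2l fK.
by rewrite ler_wpM2l ?normc_ge0// ler_expR geometric_le_lim.
Qed.

Let P_step N : nc (P N.+1 - P N) <= geometric (nc A * expR (K / (1 - r)) * K) r N.
Proof.
have -> : P N.+1 - P N = P N * (f N.+1 - 1) by rewrite PS mulrBr mulr1.
rewrite Normc.normcM /= -(mulrA _ K); apply: ler_pM; rewrite ?normc_ge0 ?P_bounded//.
apply: (le_trans (fK _)); rewrite ler_wpM2l// exprS ger_pMl ?exprn_gt0//.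
exact: ltW.
Qed.

Let cvg_of_step (u : R^nat) :
  (forall N, `|u N.+1 - u N| <= nc (P N.+1 - P N)) -> cvgn u.
Proof.
move=> uP.
have -> : u = (fun n => u 0%N + series (telescope u) n).
  by apply: funext => n; exact: eq_sum_telescope.
apply: is_cvgD; first exact: is_cvg_cst.
apply: normed_cvg; rewrite /=.
apply: (@series_le_cvg _ _ (geometric (nc A * expR (K / (1 - r)) * K) r)) => /=.
- by move=> n.
- by move=> n; rewrite !mulr_ge0 ?normc_ge0 ?expR_ge0// exprn_ge0// ltW.
- by move=> n; apply: (le_trans (uP n)); exact: P_step.
- exact: is_cvg_geometric_series.
Qed.

(** Successive partial products differ by [P N * (f N.+1 - 1)], which is dominated by a geometric
    sequence because the [P N] are bounded; the telescoping series of real and imaginary parts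
    therefore converge absolutely. *)
Lemma infinite_product_cvg :
  cvgn (fun N => complex.Re (A * \prod_(1 <= m < N.+1) f m)) /\
  cvgn (fun N => complex.Im (A * \prod_(1 <= m < N.+1) f m)).
Proof.
split; apply: cvg_of_step => N; rewrite /= -/(P _) -/(P _).
  by rewrite -raddfB; exact: normr_Re_le.
by rewrite -raddfB; exact: normr_Im_le.
Qed.

(** Once the tail sum [K r^M / (1 - r)] is at most [1/2], the inequality
    [prod (1 - e_j) >= 1 - sum e_j] shows that the factors beyond [M] shrink the modulus of [P M] by
    at most one half. *)
Lemma infinite_product_bounded_below :
  A != 0 -> (forall m, (0 < m)%N -> f m != 0) ->
  exists2 e : R, 0 < e &
    \forall N \near \oo, e <= nc (A * \prod_(1 <= m < N.+1) f m).
Proof.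
move=> A0 f0.
have P0 N : 0 < nc (P N).
  rewrite normcE_sqn sqrtr_gt0 sqn_gt0 mulf_neq0// prodf_seq_neq0.
  by apply/allP => m; rewrite mem_index_iota => /andP[m0 _]; apply: f0.
have r1' : 0 < 1 - r by rewrite subr_gt0.
have [M KM] : exists M, K * r ^+ M / (1 - r) <= 1 / 2.
  have /cvgrPdist_le/(_ ((1 - r) / 2)) := @cvg_geometric R K r r_norm.
  rewrite divr_gt0// => /(_ isT)[M _ /(_ M (leqnn M))]; rewrite /= sub0r normrN.
  move=> h; exists M; rewrite ler_pdivrMr// (le_trans (ler_norm _))//.
  by apply: (le_trans h); rewrite mul1r mulrC.
have KM0 : 0 <= K * r ^+ M by rewrite mulr_ge0// exprn_ge0// ltW.
pose S j := series (geometric (K * r ^+ M) r) j.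
have S2 j : S j <= 1 / 2.
  by apply: le_trans KM; exact: geometric_le_lim.
have S0 j : 0 <= S j.
  by rewrite /S seriesEnat sumr_ge0// => i _; rewrite geometric_ge0// ltW.
have PM j : nc (P M) * (1 - S j) <= nc (P (M + j)%N).
  elim: j => [|j IH]; first by rewrite /S seriesEnat /= big_geq// subr0 mulr1 addn0.
  have := S2 j.+1; have := S2 j; have := S0 j.
  rewrite addnS PS (Normc.normcM (P (M + j)%N)) /S seriesSr -/(S j).
  set e := geometric _ _ j.
  have e0 : 0 <= e by rewrite /e geometric_ge0// ltW.
  have fe : 1 - e <= nc (f (M + j).+1).
    have : nc (f (M + j).+1 - 1) <= e.
      apply: (le_trans (fK _)); rewrite /e/= -mulrA ler_wpM2l//.
      by rewrite -exprD exprS ger_pMl ?exprn_gt0// ltW.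
    have := normcD_le (f (M + j).+1) (1 - f (M + j).+1).
    rewrite addrC subrK Normc.normc1 -(opprB _ 1) => h1 h2.
    move: h1; have -> : nc (- (f (M + j).+1 - 1)) = nc (f (M + j).+1 - 1).
      by case: (_ - _) => a b /=; rewrite !sqrrN.
    lra.
  have := P0 M; move: IH fe; rewrite -/(S j).
  move: (nc (P M)) (nc (P (M + j)%N)) (nc (f _)) (S j) => a b c s sab ec a0 s0 s2 se2.
  have b0 : 0 <= b by apply: le_trans sab; rewrite mulr_ge0 ?ltW//; lra.
  apply: (@le_trans _ _ (b * (1 - e))); last by rewrite ler_wpM2l.
  apply: (@le_trans _ _ (a * (1 - s) * (1 - e))); last by rewrite ler_wpM2r//; lra.
  rewrite -mulrA (ler_wpM2l (ltW a0))// -subr_ge0.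
  have -> : (1 - s) * (1 - e) - (1 - (s + e)) = s * e by ring.
  exact: mulr_ge0.
exists (nc (P M) / 2); first by rewrite divr_gt0.
exists M => // N /= MN; rewrite -/(P N) -(subnKC MN).
apply: le_trans (PM _); rewrite ler_wpM2l ?normc_ge0//.
by have := S2 (N - M)%N; lra.
Qed.

End InfiniteProduct.
End ComplexProduct.

(** * The zeros of theta lie in the lattice generated by 1 and tau *)

Section ThetaZeros.
Variable R : realType.
Local Notation nc := (@Normc.normc R).

Lemma cexpM (a b c d : R) : cexp a b * cexp c d = cexp (a + c) (b + d).
Proof.
rewrite /cexp expRD cosD sinD; apply/eqP; rewrite eq_complex /=.
by apply/andP; split; apply/eqP; ring.
Qed.

Lemma cexp00 : cexp (0 : R) 0 = 1.
Proof. by rewrite /cexp expR0 cos0 sin0 !(mul1r, mulr0). Qed.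

Lemma normc_cexp (a b : R) : nc (cexp a b) = expR a.
Proof.
rewrite /= !exprMn -mulrDr cos2Dsin2 mulr1 sqrtr_sqr ger0_norm// expR_ge0 //.
Qed.

Lemma e2piD (c : R) (x y : R[i]) : e2pi c (x + y) = e2pi c x * e2pi c y.
Proof. by rewrite /e2pi cexpM; case: x y => [a b] [a' b'] /=; congr cexp; ring. Qed.

Lemma e2pi_mul (c d : R) (x : R[i]) : e2pi c x * e2pi d x = e2pi (c + d) x.
Proof. by rewrite /e2pi cexpM; congr cexp; ring. Qed.

Lemma e2pi1N (x : R[i]) : e2pi 1 (- x) = e2pi (-1) x.
Proof. by rewrite /e2pi; case: x => a b /=; congr cexp; ring. Qed.

Lemma e2piX (x : R[i]) m : e2pi 1 x ^+ m = e2pi 1 (m%:R * x).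
Proof.
elim: m => [|m IH].
  by rewrite expr0 mul0r /e2pi /= !mulr0 cexp00.
by rewrite exprS IH -e2piD -[in RHS]natr1 mulrDl mul1r addrC.
Qed.

Lemma sin_add_pi_int (a : R) (m : int) : `|sin (a + pi * m%:~R)| = `|sin a|.
Proof.
have H (b : R) k : `|sin (b + pi * k%:R)| = `|sin b|.
  elim: k => [|k IH]; first by rewrite mulr0 addr0.
  by rewrite -natr1 mulrDr mulr1 addrA sinDpi normrN.
case: m => k; first exact: H.
rewrite NegzE mulrNz -(H (a + _) k.+1) -addrA.
by rewrite mulrN addNr addr0.
Qed.

(** The modulus [exp (-2 pi Im x)] forces [Im x = 0]. The double angle formula then gives
    [sin (pi a) = 0] for [a = Re x], and the sine is positive at [pi] times a nonzero fractional
    part. *)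
Lemma e2pi_eq1 (x : R[i]) : e2pi 1 x = 1 ->
  complex.Im x = 0 /\ exists m : int, complex.Re x = m%:~R.
Proof.
move=> h.
have : nc (e2pi 1 x) = 1 by rewrite h Normc.normc1.
rewrite normc_cexp -[RHS](@expR0 R) => /expR_inj /eqP.
rewrite mulf_eq0 oppr_eq0 mulr1 mulf_eq0 pnatr_eq0 (gt_eqF (pi_gt0 R)) /= => /eqP x0.
split=> //; exists (Num.floor (complex.Re x)).
move: h; rewrite /e2pi x0 mulr0 /cexp expR0 !mul1r mulr1 => -[h _].
set a := complex.Re x in h *; pose f := a - (Num.floor a)%:~R.
have f0 : 0 <= f by rewrite subr_ge0 floor_le.
have f1 : f < 1 by rewrite ltrBlDl -[_ + 1]/(_ + 1%:~R) -intrD floorD1_gt.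
have : `|sin (pi * f)| = 0.
  rewrite -(sin_add_pi_int _ (Num.floor a)) -mulrDr subrK.
  have : cos (pi * a *+ 2) = 1 by rewrite -h; congr cos; ring.
  rewrite cos_mulr2n => h2; apply/eqP; rewrite normr_eq0 -sqrf_eq0 sin2cos2.
  by apply/eqP; move: h2; rewrite mulr2n; lra.
move/eqP; rewrite normr_eq0 => sf.
have [f00|fn0] := eqVneq f 0; first by apply/eqP; rewrite -subr_eq0 -/f f00.
have : 0 < sin (pi * f).
  have fgt0 : 0 < f by rewrite lt_def fn0.
  apply: sin_gt0_pi; rewrite mulr_gt0 ?pi_gt0//=.
  by rewrite gtr_pMr ?pi_gt0.
by rewrite (eqP sf) ltxx.
Qed.

(** Off the lattice no factor vanishes and the factors tend to 1 geometrically with ratio [|q| < 1],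
    so the partial products stay away from 0 and cannot converge to it. *)
Lemma theta_eq0 (tau x : R[i]) : 0 < complex.Im tau -> theta tau x = 0 ->
  exists m k : int, x = m%:~R + k%:~R * tau.
Proof.
move=> tau0 th0; apply: contrapT => xG.
pose q := e2pi 1 tau; pose t := e2pi 1 x; pose ti := e2pi (-1) x.
pose A := e2pi (1/2) x - e2pi (-1/2) x.
pose f m := (1 - q ^+ m * t) * (1 - q ^+ m * ti).
have intP (y : R[i]) : complex.Im y = 0 /\ (exists m : int, complex.Re y = m%:~R) ->
    exists m : int, y = m%:~R.
  case: y => a b /= [-> [m ->]]; exists m.
  by rewrite -(rmorph_int (real_complex R)).
have A0 : A != 0.
  rewrite subr_eq0; apply/eqP => h; apply: xG.
  have [] := intP x.
    apply: e2pi_eq1; have : e2pi (1/2) x * e2pi (1/2) x = e2pi (1/2) x * e2pi (-1/2) x.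
      by rewrite {2}h.
    rewrite !e2pi_mul (_ : 1 / 2 + 1 / 2 = 1)//; last by lra.
    rewrite (_ : 1 / 2 + -1 / 2 = 0); last by lra.
    by move=> ->; rewrite /e2pi !(mulr0, mul0r, oppr0) cexp00.
  by move=> m ->; exists m, 0; rewrite mul0r addr0.
(* A zero of the first factor gives [x = k - m tau], a zero of the second [x = m tau - k]. *)
have f0 m : (0 < m)%N -> f m != 0.
  move=> _; rewrite mulf_neq0// subr_eq0; apply/eqP => h; apply: xG.
    have [] := intP (m%:R * tau + x).
      by apply: e2pi_eq1; rewrite e2piD -e2piX.
    move=> k hk; exists k, (- m%:Z); rewrite -hk mulrNz.
    by rewrite mulNr addrAC addrN add0r.
  have [] := intP (m%:R * tau - x).
    by apply: e2pi_eq1; rewrite e2piD -e2piX h e2pi1N.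
  move=> k hk; exists (- k), m%:Z; rewrite mulrNz -hk.
  by rewrite opprB subrK.
pose r := nc q.
have r0 : 0 < r by rewrite /r normc_cexp expR_gt0.
have r1 : r < 1.
  rewrite /r normc_cexp -[ltRHS](@expR0 R) ltr_expR mulNr oppr_lt0.
  by rewrite !mulr_gt0 ?pi_gt0.
have ncX m : nc (q ^+ m) = r ^+ m.
  elim: m => [|m IH]; first by rewrite !expr0 Normc.normc1.
  by rewrite !exprS Normc.normcM IH.
(* The three terms come from expanding [f m - 1]; the quadratic one carries [q^(2m)], which is
   bounded by [r^m] since [r < 1]. *)
pose K := nc t + nc ti + nc (t * ti).
have K0 : 0 <= K by rewrite !addr_ge0 ?normc_ge0.
have ncN (z : R[i]) : nc (- z) = nc z by case: z => a b /=; rewrite !sqrrN.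
have fK m : nc (f m - 1) <= K * r ^+ m.
  have -> : f m - 1 = - (q ^+ m * t) + - (q ^+ m * ti) + q ^+ m * (q ^+ m * (t * ti)).
    by rewrite /f; ring.
  apply: (le_trans (normcD_le _ _)); rewrite /K !mulrDl; apply: lerD.
    apply: (le_trans (normcD_le _ _)); rewrite !ncN !Normc.normcM ncX.
    by rewrite mulrC (mulrC (nc ti)).
  rewrite !(Normc.normcM (q ^+ m)) ncX mulrA mulrC ler_wpM2l ?normc_ge0//.
  by rewrite ler_piMl ?exprn_ge0 ?exprn_ile1// ltW.
have [cR cI] := infinite_product_cvg A K0 r0 r1 fK.
have [e e0 he] := infinite_product_bounded_below K0 r0 r1 fK A0 f0.
set P := (fun N => A * \prod_(1 <= m < N.+1) f m) in cR cI he.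
have PE : theta_partial tau x = P by [].
move: th0; rewrite /theta PE => -[limR limI].
have : (fun N => sqn (P N)) @ \oo --> (0 : R).
  rewrite -[X in _ --> X](_ : 0 * 0 + 0 * 0 = 0); last by rewrite mul0r addr0.
  apply: cvgD; under eq_fun do rewrite expr2; apply: cvgM.
  - by rewrite -[X in _ --> X]limR.
  - by rewrite -[X in _ --> X]limR.
  - by rewrite -[X in _ --> X]limI.
  - by rewrite -[X in _ --> X]limI.
move=> cS.
have : e ^+ 2 <= 0.
  rewrite -(cvg_lim _ cS)//; apply: limr_ge; first by apply/cvg_ex; exists 0.
  near=> N; have : e <= nc (P N) by near: N.
  rewrite normcE_sqn => h; rewrite -(sqr_sqrtr (sqn_ge0 (P N))).
  by rewrite ler_sqr// nnegrE ltW// (lt_le_trans e0).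
by rewrite leNgt exprn_gt0.
Unshelve. all: by end_near. Qed.

End ThetaZeros.

(** * Avoiding countable sets of reals *)

Section CountableAvoidance.
Variable R : realType.

(** A countable union of countable sets has Lebesgue measure 0, so it cannot contain [[0, 1]]. *)
Lemma countable_avoid (E : countType) (P : E -> set R) :
  (forall e, countable (P e)) -> exists t, forall e, ~ P e t.
Proof.
move=> cP; apply: contrapT => h.
have : lebesgue_measure (`[0, 1]%classic : set R) = 0%E.
  apply: countable_lebesgue_measure0.
  apply: (@sub_countable _ _ _ (\bigcup_(e in [set: E]) P e)).
    apply: subset_card_le => t _; apply: contrapT => nt; apply: h; exists t => e et.
    by apply: nt; exists e.
  exact: bigcup_countable.
by rewrite lebesgue_measure_itv /= lte_fin ltr01 oppr0 adde0 => /eqP; rewrite eqe oner_eq0.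
Qed.

Lemma countable_root (p : {poly R}) : p != 0 -> countable [set t | root p t].
Proof.
move=> p0; apply: finite_set_countable.
apply: (@sub_finite_set _ _ [set` rootsR p]); last exact: finite_seq.
by move=> t /= rt; rewrite -(roots_on_rootsR p0) in_itv rt.
Qed.

End CountableAvoidance.

(** * The exponential system solved by convex minimisation, with quantitative stability *)

Section ConvexSystem.
Variable R : realType.

(** The left side is at most [m s^2] by completing the square, and [s^2 <= exp (2|s|)]. The slope
    [c] is arbitrary, which is what coercivity against a linear term requires. *)
Lemma expR_superlinear (m c s : R) : 0 < m ->
  c * `|s| - c ^+ 2 / (4 * m) <= m * (expR (2 * s) + expR (- (2 * s))).
Proof.
move=> m0; apply: (@le_trans _ _ (m * `|s| ^+ 2)).
  have -> : m * `|s| ^+ 2 = (m * `|s| - c / 2) ^+ 2 / m + (c * `|s| - c ^+ 2 / (4 * m)).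
    by field; rewrite gt_eqF.
  by rewrite lerDr divr_ge0 ?sqr_ge0// ltW.
rewrite ler_pM2l//.
have H (x : R) : 0 <= x -> x ^+ 2 <= expR (2 * x).
  move=> x0; rewrite mulr2n mulrDl mul1r expRD -expr2 ler_sqr ?nnegrE ?expR_ge0//.
  by apply: le_trans (expR_ge1Dx x); rewrite lerDr.
have [s0|s0] := leP 0 s.
  by rewrite ger0_norm// (le_trans (H _ s0))// lerDl expR_ge0.
rewrite ltr0_norm//; have /H h : 0 <= - s by rewrite oppr_ge0 ltW.
by rewrite (le_trans h)// mulrN lerDr expR_ge0.
Qed.

Lemma expR_sub_expRN (x : R) : x ^+ 2 <= (expR x - expR (- x)) * x.
Proof.
have H (y : R) : 0 <= y -> y ^+ 2 <= (expR y - expR (- y)) * y.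
  move=> y0; rewrite expr2 ler_wpM2r//.
  have h1 := expR_ge1Dx y; have h2 := expR_gt0 y.
  rewrite expRN lerBrDr -lerBrDl.
  have : (expR y)^-1 <= 1 by rewrite invf_le1//; lra.
  lra.
have [x0|x0] := leP 0 x; first exact: H.
have /H : 0 <= - x by rewrite oppr_ge0 ltW.
by rewrite opprK sqrrN mulrN -mulNr opprB.
Qed.

(** With [E = exp (t + s)] the difference factors as [(A E + A' / E) / 2] times [2 sinh (t - s)].
    The first factor is at least [sqrt (A A') >= k] by the arithmetic-geometric mean inequality. *)
Lemma expR_monotone (A A' k s t : R) : 0 <= A -> 0 <= A' -> 0 <= k ->
  k ^+ 2 <= A * A' ->
  k * (t - s) ^+ 2 <=
  ((A * expR (2 * t) - A' * expR (- (2 * t))) / 2 -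
   (A * expR (2 * s) - A' * expR (- (2 * s))) / 2) * (t - s).
Proof.
move=> A0 A'0 k0 kA.
pose E := expR (t + s); have E0 : 0 < E by exact: expR_gt0.
have -> : (A * expR (2 * t) - A' * expR (- (2 * t))) / 2 -
   (A * expR (2 * s) - A' * expR (- (2 * s))) / 2 =
   (A * E + A' * E^-1) / 2 * (expR (t - s) - expR (- (t - s))).
  have -> : 2 * t = (t + s) + (t - s) by ring.
  have -> : 2 * s = (t + s) - (t - s) by ring.
  rewrite /E; move: (t + s) (t - s) => u v.
  by rewrite (opprD u v) (opprB u v) !expRD !expRN; ring.
rewrite -mulrA; apply: ler_pM; rewrite ?sqr_ge0 ?expR_sub_expRN//.
rewrite ler_pdivlMr// -ler_sqr ?nnegrE ?mulr_ge0 ?addr_ge0 ?mulr_ge0 ?invr_ge0 ?(ltW E0)//.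
have -> : (A * E + A' * E^-1) ^+ 2 = (A * E - A' * E^-1) ^+ 2 + 4 * (A * A').
  by field; rewrite gt_eqF.
by have := sqr_ge0 (A * E - A' * E^-1); lra.
Qed.

Lemma is_derive_affine (b c h : R) : is_derive h 1 (fun x => b + x * c) c.
Proof.
rewrite (_ : (fun x => b + x * c) = cst b + c *: id); last first.
  by apply: funext => x; rewrite /= mulrC.
by apply: is_derive_eq; rewrite add0r /GRing.scale /= mulr1.
Qed.

Lemma is_derive_expR_affine (a b c h : R) :
  is_derive h 1 (fun x => a * expR (b + x * c)) (a * (expR (b + h * c) * c)).
Proof.
have dc := is_derive_affine b c h.
have dE := @is_derive1_comp R expR (fun x => b + x * c) h _ _
  (is_derive_expR (b + h * c)) dc.
exact: (@is_deriveZ R R R _ a h 1 _ dE).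
Qed.

Variables (n k : nat) (D : 'M[R]_(k, n)).

(** Zeroing the columns outside [J] leaves a matrix [D'] with free rows. A matrix [L] with
    [D' L = 1] recovers [a] from the retained coordinates, and the entries of [L] give the
    constant. *)
Lemma left_inverse_bound (J : pred 'I_n) :
  (forall a : 'rV_k, (forall i, J i -> (a *m D) 0 i = 0) -> a = 0) ->
  exists2 c : R, 0 < c &
    forall a : 'rV_k, \sum_j `|a 0 j| <= c * \sum_(i | J i) `|(a *m D) 0 i|.
Proof.
move=> inj; pose D' := \matrix_(j, i) (if J i then D j i else 0).
have D'E (a : 'rV_k) i : (a *m D') 0 i = if J i then (a *m D) 0 i else 0.
  rewrite !mxE; case: ifP => Ji; first by apply: eq_bigr => j _; rewrite mxE Ji.
  by rewrite big1// => j _; rewrite mxE Ji mulr0.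
have /row_freeP[L DL] : row_free D'.
  apply: inj_row_free => v vD; apply: inj => i Ji.
  by have := D'E v i; rewrite vD Ji mxE => <-.
pose T := 1 + \sum_i \sum_j `|L i j|.
have LT i : \sum_j `|L i j| <= T.
  rewrite /T (bigD1 i)//= addrCA lerDl addr_ge0// sumr_ge0// => i' _.
  by rewrite sumr_ge0.
exists T; first by rewrite ltr_pwDl// sumr_ge0// => i _; rewrite sumr_ge0.
move=> a; have -> : \sum_j `|a 0 j| = \sum_j `|\sum_i (a *m D') 0 i * L i j|.
  by apply: eq_bigr => j _; rewrite -[in LHS](mulmx1 a) -DL mulmxA mxE.
apply: (@le_trans _ _ (\sum_j \sum_i `|(a *m D') 0 i| * `|L i j|)).
  apply: ler_sum => j _; apply: (le_trans (ler_norm_sum _ _ _)).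
  by apply: ler_sum => i _; rewrite normrM.
rewrite exchange_big mulr_sumr [leRHS]big_mkcond; apply: ler_sum => i _ /=.
rewrite -mulr_sumr D'E; case: ifP => _; last by rewrite normr0 mul0r.
by rewrite mulrC ler_wpM2r.
Qed.

(** The gradient in [s] of the convex function [sum_i (A_i exp (2 (s D)_i) + A'_i exp (-2 (s D)_i))
    / 4]. For [D = B^T], [A_i = |z_i|^2] and [A'_i] the weighted [|w_i|^2], it is the real moment of
    the point displaced by [s]. *)
Definition grad (A A' : 'I_n -> R) (s : 'rV[R]_k) : 'rV[R]_k :=
  \row_j \sum_i (A i * expR (2 * (s *m D) 0 i) -
                 A' i * expR (- (2 * (s *m D) 0 i))) / 2 * D j i.

(** Pairing the difference of gradients with [a = t - s] gives at least [kappa] times the sum of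
    [(a D)_i^2] over [J], and at most [eps] times the l1 norm of [a]. Replacing [x^2] by its lower
    bound [eta |x| - eta^2 / 4] makes the comparison linear; [eta] is free and controls the final
    bound. The constants [c] and [kappa] can serve for all nearby [A], [A'] at once. *)
Lemma grad_stable (A A' : 'I_n -> R) (J : pred 'I_n) (c kappa eps eta : R)
    (s t : 'rV_k) :
  (forall i, 0 <= A i) -> (forall i, 0 <= A' i) ->
  (forall a : 'rV_k, \sum_j `|a 0 j| <= c * \sum_(i | J i) `|(a *m D) 0 i|) ->
  0 < c -> 0 < kappa -> (forall i, J i -> kappa ^+ 2 <= A i * A' i) ->
  0 <= eps -> (forall j, `|grad A A' t 0 j - grad A A' s 0 j| <= eps) ->
  0 < eta -> eps * c <= eta * kappa / 2 ->
  \sum_j `|(t - s) 0 j| <= c * (n%:R * eta / 2).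
Proof.
move=> A0 A'0 hc c0 ka0 hka e0 he eta0 hee.
set a := t - s; pose T := \sum_(i | J i) `|(a *m D) 0 i|.
apply: (le_trans (hc a)); rewrite -/T ler_pM2l//.
have T0 : 0 <= T by rewrite sumr_ge0.
pose f i x := (A i * expR (2 * x) - A' i * expR (- (2 * x))) / 2.
have aE i : (a *m D) 0 i = (t *m D) 0 i - (s *m D) 0 i.
  by rewrite /a mulmxBl !mxE.
have h1 : \sum_i (f i ((t *m D) 0 i) - f i ((s *m D) 0 i)) * (a *m D) 0 i
    <= eps * (c * T).
  have -> : \sum_i (f i ((t *m D) 0 i) - f i ((s *m D) 0 i)) * (a *m D) 0 i
      = \sum_j (grad A A' t 0 j - grad A A' s 0 j) * a 0 j.
    under eq_bigr do rewrite [(a *m D) _ _]mxE mulr_sumr.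
    rewrite exchange_big; apply: eq_bigr => j _ /=.
    rewrite !(mxE _ (fun _ j => \sum_i _)) -sumrB mulr_suml.
    by apply: eq_bigr => i _; rewrite /f; ring.
  apply: (@le_trans _ _ (\sum_j eps * `|a 0 j|)).
    apply: ler_sum => j _; apply: (le_trans (ler_norm _)).
    by rewrite normrM ler_wpM2r.
  by rewrite -mulr_sumr ler_wpM2l.
(* Indices outside [J] contribute nonnegatively, by monotonicity with [k = 0], and are dropped. *)
have h2 : \sum_(i | J i) kappa * (eta * `|(a *m D) 0 i| - eta ^+ 2 / 4) <=
    \sum_i (f i ((t *m D) 0 i) - f i ((s *m D) 0 i)) * (a *m D) 0 i.
  rewrite [leLHS]big_mkcond; apply: ler_sum => i _; rewrite aE.
  case: ifP => Ji; last first.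
    apply: le_trans (@expR_monotone _ _ 0 _ _ (A0 i) (A'0 i) (lexx 0) _).
      by rewrite mul0r.
    by rewrite expr0n mulr_ge0.
  apply: le_trans (expR_monotone _ _ (A0 i) (A'0 i) (ltW ka0) (hka _ Ji)).
  rewrite ler_pM2l//; move: (_ - (s *m D) 0 i) => x.
  rewrite -[x ^+ 2]real_normK ?num_real// -subr_ge0.
  have -> : `|x| ^+ 2 - (eta * `|x| - eta ^+ 2 / 4) = (`|x| - eta / 2) ^+ 2 by field.
  exact: sqr_ge0.
have h3 : kappa * (eta * T - n%:R * (eta ^+ 2 / 4)) <= eps * (c * T).
  apply: (le_trans _ (le_trans h2 h1)); rewrite -mulr_sumr ler_pM2l// sumrB.
  rewrite /T mulr_sumr lerD2l lerN2 big_mkcond.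
  apply: (@le_trans _ _ (\sum_(i < n) eta ^+ 2 / 4)).
    by apply: ler_sum => i _; case: ifP => // _; rewrite divr_ge0// sqr_ge0.
  by rewrite sumr_const card_ord mulr_natl.
have h4 : eps * (c * T) <= eta * kappa / 2 * T by rewrite mulrA ler_wpM2r.
have ke : 0 < kappa * eta / 2 by rewrite divr_gt0// mulr_gt0.
rewrite -(ler_pM2l ke); move: (le_trans h3 h4) => h5.
rewrite -subr_ge0 in h5; rewrite -subr_ge0; apply: le_trans h5 _.
by rewrite le_eqVlt; apply/orP; left; apply/eqP; field.
Qed.

Lemma cvg_sumR (T I : Type) (F : set_system T) {FF : Filter F} (r : seq I)
    (P : pred I) (f : I -> T -> R) (l : I -> R) :
  (forall i, P i -> f i @ F --> l i) ->
  (fun t => \sum_(i <- r | P i) f i t) @ F --> \sum_(i <- r | P i) l i.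
Proof.
move=> fl; elim: r => [|i r IH].
  under eq_fun do rewrite big_nil.
  by rewrite big_nil; exact: cvg_cst.
under eq_fun do rewrite big_cons.
rewrite big_cons; case: ifP => Pi //.
by apply: cvgD => //; exact: fl.
Qed.

Lemma cvg_mulmxr (T : Type) (F : set_system T) {FF : Filter F}
    (s : T -> 'rV[R]_k) (l : 'rV[R]_k) i :
  (forall j, (fun t => s t 0 j) @ F --> l 0 j) ->
  (fun t => (s t *m D) 0 i) @ F --> (l *m D) 0 i.
Proof.
move=> sl; under eq_fun do rewrite mxE.
by rewrite mxE; apply: cvg_sumR => j _; apply: cvgM => //; exact: cvg_cst.
Qed.

Lemma cvg_expR (T : Type) (F : set_system T) {FF : Filter F} (f : T -> R) (l : R) :
  f @ F --> l -> (fun t => expR (f t)) @ F --> expR l.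
Proof. by move=> fl; apply: (@cvg_comp _ _ _ f expR _ (nbhs l)) => //; exact: continuous_expR. Qed.

(** A potential for the system: its critical points in [s] are the solutions of
    [grad A A' s = al]. *)
Let energy (A A' : 'I_n -> R) (al s : 'rV[R]_k) : R :=
  \sum_i (A i * expR (2 * (s *m D) 0 i) + A' i * expR (- (2 * (s *m D) 0 i))) / 4
  - \sum_j al 0 j * s 0 j.

Let energy_cvg A A' al (T : Type) (F : set_system T) {FF : Filter F}
    (s : T -> 'rV[R]_k) (l : 'rV[R]_k) :
  (forall j, (fun t => s t 0 j) @ F --> l 0 j) ->
  (fun t => energy A A' al (s t)) @ F --> energy A A' al l.
Proof.
move=> cs; have cD i := @cvg_mulmxr _ F _ s l i cs.
apply: cvgB; apply: cvg_sumR => i _; last by apply: cvgM => //; exact: cvg_cst.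
apply: cvgM; last exact: cvg_cst.
apply: cvgD; (apply: cvgM; [exact: cvg_cst|apply: cvg_expR]).
  by apply: cvgM; [exact: cvg_cst|exact: cD].
by apply: cvgN; apply: cvgM; [exact: cvg_cst|exact: cD].
Qed.

Let energy_continuous A A' al : continuous (energy A A' al).
Proof.
move=> s; apply: (@energy_cvg A A' al _ (nbhs s) _ id) => j.
exact: coord_continuous.
Qed.

(** On the indices where both coefficients are positive the exponentials beat any slope [b]. The
    choice [b = c N] with [N = 1 + sum_j |al_j|] absorbs the linear term and leaves a growth of
    slope one in the l1 norm. *)
Let energy_coercive (A A' : 'I_n -> R) (al : 'rV_k) :
  (forall i, 0 <= A i) -> (forall i, 0 <= A' i) ->
  (forall a : 'rV_k, (forall i, (0 < A i) && (0 < A' i) -> (a *m D) 0 i = 0) -> a = 0) ->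
  exists K : R, forall s : 'rV_k, \sum_j `|s 0 j| - K <= energy A A' al s.
Proof.
move=> A0 A'0 /left_inverse_bound[c c0 hc].
pose J i := (0 < A i) && (0 < A' i).
pose m i := Num.min (A i) (A' i) / 4.
pose N := 1 + \sum_j `|al 0 j|.
have N0 : 0 <= N by rewrite addr_ge0// sumr_ge0.
pose b := c * N.
exists (\sum_(i | J i) b ^+ 2 / (4 * m i)) => s.
have h1 : \sum_(i | J i) (b * `|(s *m D) 0 i| - b ^+ 2 / (4 * m i)) <=
   \sum_i (A i * expR (2 * (s *m D) 0 i) + A' i * expR (- (2 * (s *m D) 0 i))) / 4.
  rewrite [leLHS]big_mkcond; apply: ler_sum => i _; case: ifP => Ji; last first.
    by rewrite divr_ge0// addr_ge0// mulr_ge0// expR_ge0.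
  have m0 : 0 < m i by rewrite divr_gt0// lt_min.
  apply: (le_trans (expR_superlinear _ _ m0)); rewrite mulrDr [leRHS]mulrDl.
  apply: lerD; rewrite /m mulrAC ler_pM2r ?invr_gt0// ler_wpM2r ?expR_ge0//.
    by rewrite ge_min lexx.
  by rewrite ge_min lexx orbT.
have h2 : \sum_j al 0 j * s 0 j <= (N - 1) * \sum_j `|s 0 j|.
  rewrite mulr_sumr; apply: ler_sum => j _; apply: (le_trans (ler_norm _)).
  rewrite normrM ler_wpM2r// /N addrC addKr (bigD1 j)//= lerDl.
  by rewrite sumr_ge0.
have h3 : N * \sum_j `|s 0 j| <= b * \sum_(i | J i) `|(s *m D) 0 i|.
  by rewrite /b (mulrC c) -mulrA ler_wpM2l.
move: h1; rewrite sumrB -(mulr_sumr _ _ _ b) => h1.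
apply: le_trans (lerB h1 h2).
rewrite -lerBlDr opprK [leLHS](_ : _ = N * \sum_j `|s 0 j| - \sum_(i | J i) b ^+ 2 / (4 * m i)).
  by rewrite lerD2r.
by ring.
Qed.

Lemma grad_surjective (A A' : 'I_n -> R) (al : 'rV_k) :
  (forall i, 0 <= A i) -> (forall i, 0 <= A' i) ->
  (forall a : 'rV_k, (forall i, (0 < A i) && (0 < A' i) -> (a *m D) 0 i = 0) -> a = 0) ->
  exists s, grad A A' s = al.
Proof.
move=> A0 A'0 inj; have [K hK] := energy_coercive al A0 A'0 inj.
(* Outside the box of half-width [rho] coercivity makes the energy exceed [E 0], so a minimum over
   the compact box is a global one. *)
pose E := energy A A' al; pose rho := E 0 + K.
have E0K : 0 <= rho.
  rewrite /rho -lerBlDr sub0r; apply: le_trans (hK 0).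
  by rewrite big1 ?sub0r// => j _; rewrite mxE normr0.
pose box := [set v : 'rV[R]_k | forall j, `[- rho, rho]%classic (v ord0 j)].
have box0 : box 0 by move=> j; rewrite /= mxE in_itv/= oppr_le0 E0K.
have cbox : compact box by apply: (@rV_compact _ _ (fun=> `[- rho, rho]%classic)) => j; exact: segment_compact.
have [] := @compact_EVT_min _ _ E box _ cbox _; first by exists 0.
  by apply: continuous_subspaceT; exact: energy_continuous.
move=> s _ minbox.
have smin t : E s <= E t.
  have [tb|tb] := pselect (box t); first by apply: minbox; rewrite inE.
  apply: (@le_trans _ _ (E 0)); first by apply: minbox; rewrite inE.
  move/existsNP: tb => [j /negP]; rewrite /= in_itv/= -ler_norml -ltNge => tj.
  apply: le_trans (hK t); rewrite lerBrDr -/rho (le_trans (ltW tj))//.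
  by rewrite (bigD1 j)//= lerDl sumr_ge0.
exists s; apply/rowP => j.
(* The [j]-th equation of the system is the vanishing of the derivative, at the minimum, along the
   [j]-th coordinate line. *)
pose phi (h : R) := E (s + h *: delta_mx 0 j).
pose g i := (s *m D) 0 i.
have phiE h : phi h =
  \sum_i (A i * expR (2 * (g i + h * D j i)) + A' i * expR (- (2 * (g i + h * D j i)))) / 4
  - (\sum_j' al 0 j' * s 0 j' + h * al 0 j).
  rewrite /phi /E /energy; congr (_ - _).
    apply: eq_bigr => i _; rewrite mulmxDl -scalemxAl -rowE !mxE -/(g i).
    by rewrite /g !mxE.
  rewrite (eq_bigr (fun i => al 0 i * s 0 i + h * al 0 j * (i == j)%:R)); last first.
    by move=> i _; rewrite !mxE eqxx /=; case: eqVneq => [->|_]; rewrite /=; ring.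
  rewrite big_split /= -mulr_sumr; congr (_ + _).
  by rewrite (bigD1 j)//= eqxx big1 ?addr0 ?mulr1// => i /negPf ->.
have dphi (h : R) : is_derive h 1 phi
  (\sum_i (A i * expR (2 * (g i + h * D j i)) - A' i * expR (- (2 * (g i + h * D j i)))) / 2 * D j i
   - al 0 j).
  have -> : phi = (fun h => \sum_i (A i * expR (2 * (g i + h * D j i)) + A' i * expR (- (2 * (g i + h * D j i)))) / 4
  - (\sum_j' al 0 j' * s 0 j' + h * al 0 j)) by apply: funext.
  apply: is_deriveB; last exact: is_derive_affine.
  rewrite (_ : (fun x => _) = \sum_i
    ((fun x => A i / 4 * expR (2 * g i + x * (2 * D j i))) +
     (fun x => A' i / 4 * expR (- (2 * g i) + x * (- (2 * D j i)))))); last first.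
    apply: funext => x; rewrite fct_sumE; apply: eq_bigr => i _ /=.
    rewrite mulrDl -!(mulrAC _ 4^-1); congr (_ * expR _ + _ * expR _); ring.
  apply: is_derive_sum => i.
  apply: (@is_derive_eq _ _ _ _ _ _ _ _ (is_deriveD (is_derive_expR_affine _ _ _ _)
    (is_derive_expR_affine _ _ _ _))).
  rewrite (_ : - (2 * g i) + h * - (2 * D j i) = - (2 * (g i + h * D j i))); last by ring.
  rewrite (_ : 2 * g i + h * (2 * D j i) = 2 * (g i + h * D j i)); last by ring.
  by field.
have d0 : is_derive (0 : R) 1 phi 0.
  apply: (@derive1_at_min R phi (-1) 1 0); first by lra.
  - by move=> t _; have [] := dphi t.
  - by rewrite in_itv/=; apply/andP; split; lra.
  - by move=> t _; rewrite /phi scale0r addr0.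
have := @derive_val _ _ _ _ _ _ _ d0; rewrite (@derive_val _ _ _ _ _ _ _ (dphi 0)).
move/eqP; rewrite subr_eq0 => /eqP <-; rewrite mxE; apply: eq_bigr => i _.
by rewrite mul0r addr0.
Qed.

End ConvexSystem.

(** * Limits of complex-valued functions along filters *)

Section ComplexLimits.
Variables (R : realType) (T : Type) (F : set_system T).
Context {FF : Filter F}.

(** Componentwise, because points of the space are matrices of real coordinates. *)
Definition ccvg (f : T -> R[i]) (l : R[i]) : Prop :=
  (fun t => complex.Re (f t)) @ F --> complex.Re l /\
  (fun t => complex.Im (f t)) @ F --> complex.Im l.

Lemma ccvg_cst (l : R[i]) : ccvg (fun=> l) l.
Proof. by split; exact: cvg_cst. Qed.

Lemma cReD (z w : R[i]) : complex.Re (z + w) = complex.Re z + complex.Re w.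
Proof. by case: z; case: w. Qed.

Lemma cImD (z w : R[i]) : complex.Im (z + w) = complex.Im z + complex.Im w.
Proof. by case: z; case: w. Qed.

Lemma cReB (z w : R[i]) : complex.Re (z - w) = complex.Re z - complex.Re w.
Proof. by case: z; case: w. Qed.

Lemma cImB (z w : R[i]) : complex.Im (z - w) = complex.Im z - complex.Im w.
Proof. by case: z; case: w. Qed.

Lemma cReM (z w : R[i]) : complex.Re (z * w) =
  complex.Re z * complex.Re w - complex.Im z * complex.Im w.
Proof. by case: z; case: w. Qed.

Lemma cImM (z w : R[i]) : complex.Im (z * w) =
  complex.Re z * complex.Im w + complex.Im z * complex.Re w.
Proof. by case: z; case: w. Qed.

Lemma ccvgD f g l k : ccvg f l -> ccvg g k -> ccvg (fun t => f t + g t) (l + k).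
Proof.
move=> [fR fI] [gR gI]; split.
  by under eq_fun do rewrite cReD; rewrite cReD; exact: cvgD.
by under eq_fun do rewrite cImD; rewrite cImD; exact: cvgD.
Qed.

Lemma ccvgM f g l k : ccvg f l -> ccvg g k -> ccvg (fun t => f t * g t) (l * k).
Proof.
move=> [fR fI] [gR gI]; split.
  under eq_fun do rewrite cReM.
  by rewrite cReM; apply: cvgB; exact: cvgM.
under eq_fun do rewrite cImM.
by rewrite cImM; apply: cvgD; exact: cvgM.
Qed.

Lemma ccvg_real (f : T -> R) (l : R) : f @ F --> l -> ccvg (fun t => (f t)%:C) l%:C.
Proof. by move=> fl; split=> //=; exact: cvg_cst. Qed.

Lemma cvg_sqn f l : ccvg f l -> (fun t => sqn (f t)) @ F --> sqn l.
Proof.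
by move=> [fR fI]; apply: cvgD; under eq_fun do rewrite expr2; exact: cvgM.
Qed.

Lemma ccvgV f l : l != 0 -> ccvg f l -> ccvg (fun t => (f t)^-1) l^-1.
Proof.
move=> l0 fl; have sV : (fun t => (sqn (f t))^-1) @ F --> (sqn l)^-1.
  by apply: cvgV; [rewrite sqn_eq0|exact: cvg_sqn].
have RV (z : R[i]) : complex.Re z^-1 = complex.Re z * (sqn z)^-1 by case: z.
have IV (z : R[i]) : complex.Im z^-1 = - (complex.Im z * (sqn z)^-1) by case: z.
case: fl => fR fI; split.
  under eq_fun do rewrite RV.
  by rewrite RV; exact: cvgM.
under eq_fun do rewrite IV.
by rewrite IV; apply: cvgN; exact: cvgM.
Qed.

Lemma ccvg_sqn0 f : (fun t => sqn (f t)) @ F --> (0 : R) -> ccvg f 0.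
Proof.
move=> f0.
have s0 : (fun t => Num.sqrt (sqn (f t))) @ F --> (0 : R).
  rewrite -[X in _ --> X]sqrtr0.
  by apply: (@cvg_comp _ _ _ _ Num.sqrt _ (nbhs (0 : R))) => //; exact: sqrt_continuous.
split; apply/norm_cvg0P.
  apply: (squeeze_cvgr _ (cvg_cst 0) s0); near=> t; rewrite normr_ge0 -normcE_sqn.
  exact: normr_Re_le.
apply: (squeeze_cvgr _ (cvg_cst 0) s0); near=> t; rewrite normr_ge0 -normcE_sqn.
exact: normr_Im_le.
Unshelve. all: by end_near. Qed.

(** The selector may oscillate freely along the filter; this handles points of moment zero, near
    which the sign of the moment is not constant. *)
Lemma cvg_if (b : T -> bool) (f g : T -> R) (l : R) :
  f @ F --> l -> g @ F --> l -> (fun t => if b t then f t else g t) @ F --> l.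
Proof.
move=> /cvgrPdist_le fl /cvgrPdist_le gl; apply/cvgrPdist_le => e e0.
by apply: filterS2 (fl e e0) (gl e e0) => t; case: (b t).
Qed.

Lemma ccvg_if (b : T -> bool) f g l :
  ccvg f l -> ccvg g l -> ccvg (fun t => if b t then f t else g t) l.
Proof.
move=> [fR fI] [gR gI].
by split; (under eq_fun do rewrite fun_if); exact: cvg_if.
Qed.

Lemma ccvg_near f g l : F [set t | f t = g t] -> ccvg f l -> ccvg g l.
Proof.
move=> fg [fR fI]; split.
  by apply: cvg_trans fR; apply: near_eq_cvg; apply: filterS fg => t ->.
by apply: cvg_trans fI; apply: near_eq_cvg; apply: filterS fg => t ->.
Qed.

End ComplexLimits.

Lemma cvg_mx (R : realType) (T : Type) (F : set_system T) {FF : Filter F} m n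
    (f : T -> 'M[R]_(m, n)) (l : 'M[R]_(m, n)) :
  (forall i j, (fun t => f t i j) @ F --> l i j) -> f @ F --> l.
Proof.
move=> fl; apply/cvg_ballP => e e0.
have : F [set t | forall ij : 'I_m * 'I_n, ball (l ij.1 ij.2) e (f t ij.1 ij.2)].
  apply: filter_forall => -[i j] /=.
  by have /cvg_ballP/(_ e e0) := fl i j.
by apply: filterS => t h; split => // i j; exact: (h (i, j)).
Qed.

(** * Complex coordinates of points and their continuity *)

Section Points.
Variable R : realType.
Variable n : nat.
Implicit Types p q : 'M[R]_(6, n).

Lemma zc_pt (z w x : 'I_n -> R[i]) i : zc (pt z w x) i = z i.
Proof. by rewrite /zc !mxE /=; case: (z i). Qed.

Lemma wc_pt (z w x : 'I_n -> R[i]) i : wc (pt z w x) i = w i.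
Proof. by rewrite /wc !mxE /=; case: (w i). Qed.

Lemma xc_pt (z w x : 'I_n -> R[i]) i : xc (pt z w x) i = x i.
Proof. by rewrite /xc !mxE /=; case: (x i). Qed.

Lemma pt_ext p q : (forall i, zc p i = zc q i) -> (forall i, wc p i = wc q i) ->
  (forall i, xc p i = xc q i) -> p = q.
Proof.
move=> hz hw hx; apply/matrixP => r i.
move: (hz i) (hw i) (hx i) => [e0 e1] [e2 e3] [e4 e5].
case: r => [[|[|[|[|[|[|r]]]]]] hr] //.
- by rewrite (_ : Ordinal hr = r0) ?e0//; apply: val_inj.
- by rewrite (_ : Ordinal hr = r1) ?e1//; apply: val_inj.
- by rewrite (_ : Ordinal hr = r2) ?e2//; apply: val_inj.
- by rewrite (_ : Ordinal hr = r3) ?e3//; apply: val_inj.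
- by rewrite (_ : Ordinal hr = r4) ?e4//; apply: val_inj.
- by rewrite (_ : Ordinal hr = r5) ?e5//; apply: val_inj.
Qed.

Lemma cvg_pt (T : Type) (F : set_system T) {FF : Filter F}
    (z w x : T -> 'I_n -> R[i]) p :
  (forall i, ccvg F (fun t => z t i) (zc p i)) ->
  (forall i, ccvg F (fun t => w t i) (wc p i)) ->
  (forall i, ccvg F (fun t => x t i) (xc p i)) ->
  (fun t => pt (z t) (w t) (x t)) @ F --> p.
Proof.
move=> hz hw hx; apply: cvg_mx => r i.
under eq_fun do rewrite mxE.
case: (hz i) => h0 h1; case: (hw i) => h2 h3; case: (hx i) => h4 h5.
case: r => [[|[|[|[|[|[|r]]]]]] hr] //=.
- by rewrite (_ : Ordinal hr = r0)//; apply: val_inj.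
- by rewrite (_ : Ordinal hr = r1)//; apply: val_inj.
- by rewrite (_ : Ordinal hr = r2)//; apply: val_inj.
- by rewrite (_ : Ordinal hr = r3)//; apply: val_inj.
- by rewrite (_ : Ordinal hr = r4)//; apply: val_inj.
- by rewrite (_ : Ordinal hr = r5)//; apply: val_inj.
Qed.

Lemma ccvg_zc p i (F : set_system 'M[R]_(6, n)) {FF : Filter F} :
  F --> p -> ccvg F (fun q => zc q i) (zc p i).
Proof.
by move=> Fp; split; apply: (cvg_trans (cvg_app _ Fp)); exact: coord_continuous.
Qed.

Lemma ccvg_wc p i (F : set_system 'M[R]_(6, n)) {FF : Filter F} :
  F --> p -> ccvg F (fun q => wc q i) (wc p i).
Proof.
by move=> Fp; split; apply: (cvg_trans (cvg_app _ Fp)); exact: coord_continuous.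
Qed.

Lemma ccvg_xc p i (F : set_system 'M[R]_(6, n)) {FF : Filter F} :
  F --> p -> ccvg F (fun q => xc q i) (xc p i).
Proof.
by move=> Fp; split; apply: (cvg_trans (cvg_app _ Fp)); exact: coord_continuous.
Qed.

End Points.

(** * Equivariant homeomorphisms of level sets and their descent to quotients *)

Section LevelHomeomorphism.
Variables (R : realType) (tau : R[i]) (n d k : nat) (u : 'M[int]_(n, d)).
Variable B : 'M[R]_(n, k).
Implicit Types (p q : 'M[R]_(6, n)) (c : 'M[R]_(3, k)).
Local Notation L c := (level tau B c).

Definition weight (x : R[i]) : R :=
  expR (- (2 * pi) * (complex.Im x) ^+ 2 / complex.Im tau).

Definition moment (z w x : R[i]) : R := 2^-1 * (sqn z - weight x * sqn w).

Definition momrow p : 'rV[R]_n := \row_i moment (zc p i) (wc p i) (xc p i).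
Definition rexrow p : 'rV[R]_n := \row_i complex.Re (xc p i).
Definition imxrow p : 'rV[R]_n := \row_i complex.Im (xc p i).

Lemma weight_gt0 x : 0 < weight x. Proof. exact: expR_gt0. Qed.

(** Splits the level condition into the curve equation on each factor and three linear conditions,
    in which the moment map is right multiplication by [B]. *)
Lemma levelP (al : 'rV[R]_k) (be : 'rV[R[i]]_k) p :
  L (level_val al be) p <->
  [/\ forall i, zc p i * wc p i = theta tau (xc p i), momrow p *m B = al,
      rexrow p *m B = map_mx (@complex.Re R) be &
      imxrow p *m B = map_mx (@complex.Im R) be].
Proof.
have m0 j : muK tau B p 0 j = (momrow p *m B) 0 j.
  by rewrite !mxE /= mulr_sumr; apply: eq_bigr => i _; rewrite mxE mulrA.
have m1 j : muK tau B p 1 j = (rexrow p *m B) 0 j.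
  by rewrite !mxE /=; apply: eq_bigr => i _; rewrite mxE.
have m2 j : muK tau B p (lift 0 1) j = (imxrow p *m B) 0 j.
  by rewrite !mxE /=; apply: eq_bigr => i _; rewrite mxE.
split=> [[eX mu]|[eX e0 e1 e2]].
  split.
  - move=> i; apply/eqP; rewrite -subr_eq0 eq_complex /=.
    move/matrixP: eX => eX; have := eX 0 i; have := eX 1 i.
    by rewrite !mxE /= => -> ->; rewrite eqxx.
  - by apply/rowP => j; rewrite -m0 mu !mxE.
  - by apply/rowP => j; rewrite -m1 mu !mxE.
  - by apply/rowP => j; rewrite -m2 mu !mxE.
split.
  by apply/matrixP => r i; rewrite !mxE eX subrr /=; case: ifP.
apply/matrixP => r j; case: r => [[|[|[|r]]] hr] //.
- by rewrite (_ : Ordinal hr = 0) ?m0 ?e0 ?mxE//; apply: val_inj.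
- by rewrite (_ : Ordinal hr = 1) ?m1 ?e1 ?mxE//; apply: val_inj.
- by rewrite (_ : Ordinal hr = lift 0 1) ?m2 ?e2 ?mxE//; apply: val_inj.
Qed.

Lemma sqn_cexp0 (f : R) : sqn (cexp 0 f) = 1.
Proof. by rewrite /sqn /cexp /= expR0 !mul1r cos2Dsin2. Qed.

(** The map is total on matrices but matters only on the level set, so continuity is stated with the
    filter [within]. *)
Definition level_map c c' (f : 'M[R]_(6, n) -> 'M[R]_(6, n)) : Prop :=
  [/\ forall p, L c p -> L c' (f p),
      forall p xi, L c p -> f (actK xi p) = actK xi (f p) &
      forall p, L c p -> f @ within (L c) (nbhs p) --> f p].

Definition level_homeo c c' : Prop := exists f g,
  [/\ level_map c c' f, level_map c' c g,
      forall p, L c p -> g (f p) = p & forall p, L c' p -> f (g p) = p].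

Lemma level_homeo_sym c c' : level_homeo c c' -> level_homeo c' c.
Proof. by move=> [f [g []]]; exists g, f. Qed.

Lemma level_map_comp c c' c'' f g :
  level_map c c' f -> level_map c' c'' g -> level_map c c'' (g \o f).
Proof.
move=> [f1 f2 f3] [g1 g2 g3]; split=> [p /f1/g1//|p xi Lp /=|p Lp].
  by rewrite f2// g2//; exact: f1.
apply: (@cvg_comp _ _ _ f g _ (within (L c') (nbhs (f p)))); last exact/g3/f1.
move=> U; rewrite /within /= => hU.
have h : nbhs p [set q | L c q -> L c' (f q) -> U (f q)] := f3 p Lp _ hU.
have : nbhs p [set q | L c q -> U (f q)].
  by apply: filterS h => q hq Lq; apply: hq => //; exact: f1.
exact.
Qed.

Lemma level_homeo_trans c c' c'' :
  level_homeo c c' -> level_homeo c' c'' -> level_homeo c c''.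
Proof.
move=> [f [g [fm gm fg gf]]] [f' [g' [fm' gm' fg' gf']]].
exists (f' \o f), (g \o g'); split.
- exact: level_map_comp fm fm'.
- exact: level_map_comp gm' gm.
- by case: fm => f1 _ _ p Lp /=; rewrite fg' ?fg//; exact: f1.
- by case: gm' => f1 _ _ p Lp /=; rewrite gf ?gf'//; exact: f1.
Qed.

Lemma level_map_open c c' f (U : set 'M[R]_(6, n)) : level_map c c' f -> open U ->
  exists V : set 'M[R]_(6, n), open V /\ forall p, L c p -> (U (f p) <-> V p).
Proof.
move=> [_ _ /subspace_continuousP fc] oU.
have /open_subspaceP[V oV VE] : open (f @^-1` U : set (subspace (L c))).
  by apply: open_comp => // p _; exact: fc.
exists V; split => // p Lp; have /seteqP[h1 h2] := VE.
by split=> [Ufp|Vp]; [have [] := h2 p (conj Ufp Lp)|have [] := h1 p (conj Vp Lp)].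
Qed.

Lemma image_orbitK c c' f p : level_map c c' f -> L c p ->
  f @` orbitK u p = orbitK u (f p).
Proof.
move=> [_ fa _] Lp; apply/seteqP; split=> [_ [q [xi [uxi ->]] <-]|q [xi [uxi ->]]].
  by exists xi; split => //; rewrite fa.
by exists (actK xi p); rewrite ?fa//; exists xi.
Qed.

Lemma quot_open_preimage c c' f U : level_map c c' f ->
  quot_open tau u B c' U ->
  quot_open tau u B c [set O | orbit_space tau u B c O /\ U (f @` O)].
Proof.
move=> fm [UQ [V [oV UV]]]; split; first by move=> O [].
have [W [oW WE]] := level_map_open fm oV; exists W; split => // p Lp.
have [f1 _ _] := fm; rewrite -WE// -UV; last exact: f1.
rewrite /= (image_orbitK fm Lp); split=> [[]//|h]; split=> //.
by exists p.
Qed.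

(** By equivariance the image of an orbit is the orbit of the image, so taking images gives mutually
    inverse maps of orbit spaces; open sets pull back because a preimage is the trace of an ambient
    open set. *)
Lemma quot_homeomorphic_of_level_homeo c c' :
  level_homeo c c' -> quot_homeomorphic tau u B c c'.
Proof.
move=> [f [g [fm gm fg gf]]].
have [f1 _ _] := fm; have [g1 _ _] := gm.
exists (fun O => f @` O), (fun O => g @` O); repeat split.
- move=> _ [p [Lp ->]]; exists (f p); split; first exact: f1.
  exact: (image_orbitK fm Lp).
- move=> _ [p [Lp ->]]; exists (g p); split; first exact: g1.
  exact: (image_orbitK gm Lp).
- move=> _ [p [Lp ->]]; rewrite (image_orbitK fm Lp) (image_orbitK gm (f1 _ Lp)).
  by rewrite fg.
- move=> _ [p [Lp ->]]; rewrite (image_orbitK gm Lp) (image_orbitK fm (g1 _ Lp)).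
  by rewrite gf.
- by move=> O [].
- by case: (quot_open_preimage fm H).
- by move=> O [].
- by case: (quot_open_preimage gm H).
Qed.

End LevelHomeomorphism.

(** * Changing the modulus of a coordinate while keeping its phase *)

Section PhaseLift.
Variable R : realType.

(* The nonnegative root [r] of [r - c |th|^2 / r = 2 m]: the value of [|z|^2] at a
   point [z w = th] with moment [m] and weight [c]. *)
Definition radius2 (m c : R) (th : R[i]) : R := m + Num.sqrt (m ^+ 2 + c * sqn th).

(** Keeps the phase of [z] and makes [c |z|^2] equal to [radius2 m (c * c') th]. Having a weight for
    each coordinate lets one formula serve for [z] and, with weights exchanged and [m] negated, for
    [w]. *)
Definition rescale (m c c' : R) (z th : R[i]) : R[i] :=
  (Num.sqrt (radius2 m (c * c') th / (c * sqn z)))%:C * z.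

Lemma radius2_gt0 m c th : 0 < m -> 0 < radius2 m c th.
Proof. by move=> m0; rewrite ltr_wpDr// sqrtr_ge0. Qed.

Lemma radius2_mul m c th : 0 <= c -> radius2 m c th * radius2 (- m) c th = c * sqn th.
Proof.
move=> c0; rewrite /radius2 sqrrN.
set X := m ^+ 2 + _; have -> : (m + Num.sqrt X) * (- m + Num.sqrt X) =
  Num.sqrt X ^+ 2 - m ^+ 2 by ring.
rewrite sqr_sqrtr; first by rewrite /X addrC addKr.
by rewrite addr_ge0 ?sqr_ge0 ?mulr_ge0 ?sqn_ge0.
Qed.

Lemma radius2_sub m c th : radius2 m c th - radius2 (- m) c th = 2 * m.
Proof. by rewrite /radius2 sqrrN; ring. Qed.

Lemma radius2_ge0 m c th : 0 <= c -> 0 <= radius2 m c th.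
Proof.
move=> c0; rewrite /radius2 -lerBlDl sub0r (le_trans (ler_norm _))// normrN.
by rewrite -sqrtr_sqr ler_wsqrtr// lerDl mulr_ge0 ?sqn_ge0.
Qed.

(** Under the square root stands the square of the half sum of the two weighted moduli. *)
Lemma radius2_point (c c' : R) z w : 0 <= c -> 0 <= c' ->
  radius2 (2^-1 * (c * sqn z - c' * sqn w)) (c * c') (z * w) = c * sqn z.
Proof.
move=> c0 c'0; rewrite /radius2 sqnM.
have -> : (2^-1 * (c * sqn z - c' * sqn w)) ^+ 2 + c * c' * (sqn z * sqn w) =
  (2^-1 * (c * sqn z + c' * sqn w)) ^+ 2 by field.
rewrite sqrtr_sqr ger0_norm; first by field.
by rewrite mulr_ge0// addr_ge0// mulr_ge0// sqn_ge0.
Qed.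

Lemma sqn_real (r : R) : sqn r%:C = r ^+ 2.
Proof. by rewrite /sqn /= expr0n addr0. Qed.

Lemma sqn_rescale m c c' z th : 0 < c -> 0 <= c' -> z != 0 ->
  sqn (rescale m c c' z th) = radius2 m (c * c') th / c.
Proof.
move=> c0 c'0 z0; have s0 : 0 < sqn z by rewrite sqn_gt0.
rewrite /rescale sqnM sqn_real sqr_sqrtr.
  by field; rewrite !gt_eqF.
by rewrite divr_ge0 ?radius2_ge0 ?mulr_ge0 ?(ltW c0) ?(ltW s0).
Qed.

Lemma rescale_id (c c' : R) z w : 0 < c -> 0 <= c' -> z != 0 ->
  rescale (2^-1 * (c * sqn z - c' * sqn w)) c c' z (z * w) = z.
Proof.
move=> c0 c'0 z0; rewrite /rescale radius2_point ?(ltW c0)//.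
by rewrite divff ?sqrtr1 ?mul1r// mulf_neq0 ?sqn_eq0// gt_eqF.
Qed.

(** Both rescalings keep the phase, and the second prescribes the modulus that [z] had at first. *)
Lemma rescaleK m c c' d d' z th w : 0 < c -> 0 <= c' -> 0 < d -> 0 <= d' ->
  0 < m -> z != 0 -> m = 2^-1 * (c * sqn z - c' * sqn w) ->
  rescale m c c' (rescale m d d' z th) (z * w) = z.
Proof.
move=> c0 c'0 d0 d'0 m0 z0 mE; have s0 : 0 < sqn z by rewrite sqn_gt0.
have r0 := radius2_gt0 (d * d') th m0.
rewrite {1}/rescale sqn_rescale// {1}mE radius2_point ?(ltW c0)// /rescale.
rewrite mulrA -rmorphM -sqrtrM; last first.
  by rewrite ltW// !(divr_gt0, mulr_gt0).
rewrite [X in Num.sqrt X](_ : _ = 1); first by rewrite sqrtr1 mul1r.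
by field; rewrite !gt_eqF.
Qed.

Lemma rescaleM m c c' e z th : sqn e = 1 ->
  rescale m c c' (e * z) th = e * rescale m c c' z th.
Proof. by move=> e1; rewrite /rescale sqnM e1 mul1r mulrCA. Qed.

Lemma rescale_neq0 m c c' z th : 0 < c -> 0 <= c' -> 0 < m -> z != 0 ->
  rescale m c c' z th != 0.
Proof.
by move=> c0 c'0 m0 z0; rewrite -sqn_gt0 sqn_rescale// divr_gt0// radius2_gt0.
Qed.

Section RescaleLimit.
Variables (T : Type) (F : set_system T).
Context {FF : Filter F}.

Lemma cvg_radius2 (m c : T -> R) (th : T -> R[i]) (m0 c0 : R) th0 :
  m @ F --> m0 -> c @ F --> c0 -> ccvg F th th0 ->
  (fun t => radius2 (m t) (c t) (th t)) @ F --> radius2 m0 c0 th0.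
Proof.
move=> hm hc hth; apply: cvgD => //.
apply: (@cvg_comp _ _ _ _ Num.sqrt _ (nbhs (m0 ^+ 2 + c0 * sqn th0))); last first.
  exact: sqrt_continuous.
apply: cvgD; last by apply: cvgM => //; exact: cvg_sqn.
by under eq_fun do rewrite expr2; exact: cvgM.
Qed.

Lemma ccvg_rescale (m c c' : T -> R) (z th : T -> R[i]) (m0 c0 c'0 : R) z0 th0 :
  m @ F --> m0 -> c @ F --> c0 -> c' @ F --> c'0 -> ccvg F z z0 -> ccvg F th th0 ->
  0 < c0 -> z0 != 0 ->
  ccvg F (fun t => rescale (m t) (c t) (c' t) (z t) (th t))
         (rescale m0 c0 c'0 z0 th0).
Proof.
move=> hm hc hc' hz hth c0p z0n.
apply: ccvgM => //; apply: ccvg_real.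
set v := radius2 _ _ _ / _.
apply: (@cvg_comp _ _ _ _ Num.sqrt _ (nbhs v)); last exact: sqrt_continuous.
apply: cvgM; first by apply: cvg_radius2 => //; exact: cvgM.
apply: cvgV; first by rewrite mulf_neq0 ?sqn_eq0// gt_eqF.
by apply: cvgM => //; exact: cvg_sqn.
Qed.

End RescaleLimit.
End PhaseLift.

(** * The shear on one factor: well-definedness, inverse, equivariance, continuity *)

Section Shear.
Variables (R : realType) (tau : R[i]).
Local Notation theta := (theta tau).
Local Notation weight := (weight tau).
Local Notation moment := (moment tau).

Definition shear_x (h z w x : R[i]) : R[i] := x + h * (moment z w x)%:C.

(** The coordinate that the sign of the moment forces to be nonzero is rescaled, with the weights 1
    of [z] and [weight x'] of [w] at the new position; the other one is recovered by division from
    [z w = theta x']. *)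
Definition shear_z (h z w x : R[i]) : R[i] :=
  let m := moment z w x in let x' := shear_x h z w x in
  if 0 < m then rescale m 1 (weight x') z (theta x')
  else if m < 0 then theta x' / rescale (- m) (weight x') 1 w (theta x') else z.

Definition shear_w (h z w x : R[i]) : R[i] :=
  let m := moment z w x in let x' := shear_x h z w x in
  if 0 < m then theta x' / rescale m 1 (weight x') z (theta x')
  else if m < 0 then rescale (- m) (weight x') 1 w (theta x') else w.

Lemma moment_gt0_neq0 z w x : 0 < moment z w x -> z != 0.
Proof.
apply: contraTneq => ->; rewrite -leNgt /moment pmulr_rle0 ?invr_gt0//.
by rewrite /sqn /= !expr0n addr0 sub0r oppr_le0 mulr_ge0 ?sqn_ge0// ltW ?weight_gt0.
Qed.

Lemma moment_lt0_neq0 z w x : moment z w x < 0 -> w != 0.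
Proof.
apply: contraTneq => ->; rewrite -leNgt /moment pmulr_rge0 ?invr_gt0//.
by rewrite {2}/sqn /= !expr0n addr0 mulr0 subr0 sqn_ge0.
Qed.

Lemma momentE z w x : moment z w x = 2^-1 * (1 * sqn z - weight x * sqn w).
Proof. by rewrite mul1r. Qed.

Lemma momentN z w x : - moment z w x = 2^-1 * (weight x * sqn w - 1 * sqn z).
Proof. by rewrite /moment mul1r -mulrN opprB. Qed.

Lemma sqn0 : sqn (0 : R[i]) = 0.
Proof. by apply/eqP; rewrite sqn_eq0. Qed.

Lemma sqn_V (z : R[i]) : z != 0 -> sqn z^-1 = (sqn z)^-1.
Proof.
move=> z0; apply: (@mulfI _ (sqn z)); first by rewrite sqn_eq0.
by rewrite -sqnM !divff ?sqn_eq0// /sqn /= expr1n expr0n addr0.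
Qed.

Lemma shear_on_curve h z w x : z * w = theta x ->
  shear_z h z w x * shear_w h z w x = theta (shear_x h z w x).
Proof.
move=> zw; rewrite /shear_z /shear_w /=.
have wp := weight_gt0 tau (shear_x h z w x).
case: (ltgtP 0 (moment z w x)) => [m0|m0|m0].
- rewrite mulrC divfK// rescale_neq0// ?ltW//; exact: moment_gt0_neq0 m0.
- rewrite divfK// rescale_neq0// ?oppr_gt0//; exact: moment_lt0_neq0 m0.
- by rewrite /shear_x -m0 mulr0 addr0.
Qed.

(** One formula for the moduli, valid for every sign of the moment. It yields preservation of the
    moment and continuity at the points with [z = w = 0]. *)
Lemma sqn_shear h z w x : z * w = theta x ->
  let x' := shear_x h z w x in let m := moment z w x in
  sqn (shear_z h z w x) = radius2 m (weight x') (theta x') /\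
  weight x' * sqn (shear_w h z w x) = radius2 (- m) (weight x') (theta x').
Proof.
move=> zw x' m; rewrite /shear_z /shear_w -/m -/x' /=.
have wp : 0 < weight x' := weight_gt0 tau x'.
have rmul := radius2_mul m (theta x') (ltW wp).
case: (ltgtP 0 m) => [m0|m0|m0].
- have z0 := moment_gt0_neq0 m0.
  have e : sqn (rescale m 1 (weight x') z (theta x')) = radius2 m (weight x') (theta x').
    by rewrite sqn_rescale ?ltr01 ?(ltW wp)// mul1r divr1.
  have r0 := radius2_gt0 (weight x') (theta x') m0.
  split => //; rewrite sqnM sqn_V ?rescale_neq0 ?ltr01 ?(ltW wp)// e mulrA -rmul.
  by rewrite mulrAC divff ?mul1r// gt_eqF.
- have w0 := moment_lt0_neq0 m0; have mN0 : 0 < - m by rewrite oppr_gt0.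
  have e : weight x' * sqn (rescale (- m) (weight x') 1 w (theta x')) =
      radius2 (- m) (weight x') (theta x').
    by rewrite sqn_rescale// mulr1 mulrC divfK// gt_eqF.
  have r0 := radius2_gt0 (weight x') (theta x') mN0.
  split => //; rewrite sqnM sqn_V ?rescale_neq0//.
  apply: (mulIf (lt0r_neq0 r0)); rewrite rmul -e; field.
  by rewrite sqn_eq0 rescale_neq0.
- have xE : x' = x by rewrite /x' /shear_x -/m -m0 mulr0 addr0.
  have wx := ltW (weight_gt0 tau x).
  have := radius2_point z w (@ler01 R) wx.
  have := radius2_point w z wx (@ler01 R).
  rewrite -momentE -momentN !mul1r mulr1 (mulrC w) => h1 h2.
  by rewrite xE -zw h1 h2.
Qed.

Lemma moment_shear h z w x : z * w = theta x ->
  moment (shear_z h z w x) (shear_w h z w x) (shear_x h z w x) = moment z w x.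
Proof.
move=> /(@sqn_shear h)[e1 e2]; rewrite {1}/moment e1 e2 radius2_sub.
by rewrite mulrA mulVf ?mul1r.
Qed.

Lemma shear_xK h z w x : z * w = theta x ->
  shear_x (- h) (shear_z h z w x) (shear_w h z w x) (shear_x h z w x) = x.
Proof. by move=> zw; rewrite {1}/shear_x moment_shear// /shear_x mulNr addrK. Qed.

(** The moment is preserved, so the inverse shear takes the same branch, and rescaling back restores
    the retained coordinate. *)
Lemma shear_zwK h z w x : z * w = theta x ->
  let z' := shear_z h z w x in let w' := shear_w h z w x in
  let x' := shear_x h z w x in
  shear_z (- h) z' w' x' = z /\ shear_w (- h) z' w' x' = w.
Proof.
move=> zw z' w' x'; rewrite /shear_z /shear_w.
rewrite moment_shear// (shear_xK h zw) -zw.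
have wx := weight_gt0 tau x; have wx' := weight_gt0 tau x'.
case: (ltgtP 0 (moment z w x)) => [m0|m0|m0].
- have z0 := moment_gt0_neq0 m0.
  have -> : z' = rescale (moment z w x) 1 (weight x') z (theta x').
    by rewrite /z' /shear_z m0.
  rewrite (rescaleK _ (@ltr01 R) (ltW wx) (@ltr01 R) (ltW wx') m0 z0 (momentE z w x)).
  by split=> //; rewrite mulrC mulKf.
- have w0 := moment_lt0_neq0 m0; have mN0 : 0 < - moment z w x by rewrite oppr_gt0.
  have -> : w' = rescale (- moment z w x) (weight x') 1 w (theta x').
    by rewrite /w' /shear_w ltNge ltW//= m0.
  rewrite (mulrC z) (rescaleK _ wx (@ler01 R) wx' (@ler01 R) mN0 w0 (momentN z w x)).
  by split=> //; rewrite mulrAC divff ?mul1r.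
- by rewrite /z' /w' /shear_z /shear_w -m0 ltxx.
Qed.

Lemma moment_act (e e' z w x : R[i]) : sqn e = 1 -> sqn e' = 1 ->
  moment (e * z) (e' * w) x = moment z w x.
Proof. by move=> e1 e1'; rewrite /moment !sqnM e1 e1' !mul1r. Qed.

Lemma shear_act (e e' h z w x : R[i]) : sqn e = 1 -> sqn e' = 1 -> e * e' = 1 ->
  [/\ shear_z h (e * z) (e' * w) x = e * shear_z h z w x,
      shear_w h (e * z) (e' * w) x = e' * shear_w h z w x &
      shear_x h (e * z) (e' * w) x = shear_x h z w x].
Proof.
move=> e1 e1' ee.
have e0 : e != 0 by rewrite -sqn_gt0 e1.
have e'E : e' = e^-1 by apply: (mulfI e0); rewrite divff.
have xE : shear_x h (e * z) (e' * w) x = shear_x h z w x.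
  by rewrite /shear_x moment_act.
rewrite /shear_z /shear_w xE moment_act// !rescaleM//; split=> //.
  case: ifP => // _; case: ifP => // _.
  by rewrite e'E invfM invrK mulrCA.
case: ifP => // _; last by case: ifP.
by rewrite invfM -e'E mulrCA.
Qed.

Section ShearLimit.
(** Continuity of [theta], in filter form. It is derived later from the differentiability contained
    in the notion of regular value. *)
Hypothesis theta_cvg : forall (T : Type) (F : set_system T), Filter F ->
  forall (f : T -> R[i]) l, ccvg F f l -> ccvg F (fun t => theta (f t)) (theta l).
Variables (T : Type) (F : set_system T).
Context {FF : Filter F}.
Variables (z w x : T -> R[i]) (z0 w0 x0 : R[i]).
Hypotheses (zz : ccvg F z z0) (ww : ccvg F w w0) (xx : ccvg F x x0).

Lemma cvg_weight (f : T -> R[i]) l : ccvg F f l ->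
  (fun t => weight (f t)) @ F --> weight l.
Proof.
move=> [_ fI]; apply: cvg_expR; apply: cvgM; last exact: cvg_cst.
by apply: cvgM; [exact: cvg_cst|under eq_fun do rewrite expr2; exact: cvgM].
Qed.

Lemma cvg_moment : (fun t => moment (z t) (w t) (x t)) @ F --> moment z0 w0 x0.
Proof.
apply: cvgM; [exact: cvg_cst|apply: cvgB; first exact: cvg_sqn].
by apply: cvgM; [exact: cvg_weight|exact: cvg_sqn].
Qed.

Variable h : R[i].

Lemma ccvg_shear_x : ccvg F (fun t => shear_x h (z t) (w t) (x t)) (shear_x h z0 w0 x0).
Proof.
apply: ccvgD => //; apply: ccvgM; first exact: ccvg_cst.
by apply: ccvg_real; exact: cvg_moment.
Qed.

Hypothesis zw0 : z0 * w0 = theta x0.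
Hypothesis zw : F [set t | z t * w t = theta (x t)].

Let x' t := shear_x h (z t) (w t) (x t).
Let m t := moment (z t) (w t) (x t).
Let A t := rescale (m t) 1 (weight (x' t)) (z t) (theta (x' t)).
Let A' t := rescale (- m t) (weight (x' t)) 1 (w t) (theta (x' t)).

Let cx' : ccvg F x' (shear_x h z0 w0 x0). Proof. exact: ccvg_shear_x. Qed.
Let cth : ccvg F (fun t => theta (x' t)) (theta (shear_x h z0 w0 x0)).
Proof. exact: theta_cvg. Qed.
Let cm : m @ F --> moment z0 w0 x0. Proof. exact: cvg_moment. Qed.
Let cwt : (fun t => weight (x' t)) @ F --> weight (shear_x h z0 w0 x0).
Proof. exact: cvg_weight. Qed.

Let cA : z0 != 0 -> ccvg F A (rescale (moment z0 w0 x0) 1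
  (weight (shear_x h z0 w0 x0)) z0 (theta (shear_x h z0 w0 x0))).
Proof.
by move=> z00; apply: ccvg_rescale => //; exact: cvg_cst.
Qed.

Let cA' : w0 != 0 -> ccvg F A' (rescale (- moment z0 w0 x0)
  (weight (shear_x h z0 w0 x0)) 1 w0 (theta (shear_x h z0 w0 x0))).
Proof.
move=> w00; apply: ccvg_rescale => //; first exact: cvgN.
  exact: cvg_cst.
exact: weight_gt0.
Qed.

(** Where the limit moment is nonzero, its sign is constant nearby and a single branch is in force.
    The limit moment zero is split according to whether the limit is a fixed point of the circle. *)
Lemma ccvg_shear :
  ccvg F (fun t => shear_z h (z t) (w t) (x t)) (shear_z h z0 w0 x0) /\
  ccvg F (fun t => shear_w h (z t) (w t) (x t)) (shear_w h z0 w0 x0).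
Proof.
pose m0 := moment z0 w0 x0; pose x0' := shear_x h z0 w0 x0.
have wp := weight_gt0 tau x0'.
have [m0p|m0n|m00] := ltgtP 0 m0.
- have z00 := moment_gt0_neq0 m0p.
  have near_m : F [set t | 0 < m t] by exact: (@cvgr_gt _ _ F _ m m0 cm 0 m0p).
  split; rewrite /shear_z /shear_w -/m0 -/x0' m0p.
    apply: (@ccvg_near _ _ _ _ A); last exact: cA.
    by apply: filterS near_m => t /= mt; rewrite -/(m t) mt.
  apply: (@ccvg_near _ _ _ _ (fun t => theta (x' t) / A t)).
    by apply: filterS near_m => t /= mt; rewrite -/(m t) mt.
  apply: ccvgM => //; apply: ccvgV; last exact: cA.
  by rewrite rescale_neq0 ?ltr01 ?(ltW wp).
- have w00 := moment_lt0_neq0 m0n.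
  have near_m : F [set t | m t < 0] by exact: (@cvgr_lt _ _ F _ m m0 cm 0 m0n).
  split; rewrite /shear_z /shear_w -/m0 -/x0' ltNge ltW//= m0n.
    apply: (@ccvg_near _ _ _ _ (fun t => theta (x' t) / A' t)).
      by apply: filterS near_m => t /= mt; rewrite -/(m t) ltNge ltW//= mt.
    apply: ccvgM => //; apply: ccvgV; last exact: cA'.
    by rewrite rescale_neq0 ?oppr_gt0.
  apply: (@ccvg_near _ _ _ _ A'); last exact: cA'.
  by apply: filterS near_m => t /= mt; rewrite -/(m t) ltNge ltW//= mt.
have x0E : x0' = x0 by rewrite /x0' /shear_x -/m0 -m00 mulr0 addr0.
have zE : shear_z h z0 w0 x0 = z0 by rewrite /shear_z -/m0 -m00 ltxx.
have wE : shear_w h z0 w0 x0 = w0 by rewrite /shear_w -/m0 -m00 ltxx.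
rewrite zE wE.
have mE : sqn z0 = weight x0 * sqn w0 by move: m00; rewrite /m0 /moment; lra.
(* At a fixed point the phases carry no information, but both moduli tend to 0. Otherwise [z0] and
   [w0] are both nonzero and all branches converge to the same limit. *)
have [z00|z00] := eqVneq z0 0.
  have w00 : w0 = 0.
    apply/eqP; rewrite -sqn_eq0; move/eqP: mE; rewrite z00 sqn0 eq_sym mulf_eq0.
    by rewrite (gt_eqF (weight_gt0 _ _)).
  have th0 : theta x0' = 0 by rewrite x0E -zw0 z00 mul0r.
  have rad0 c : radius2 (0 : R) c 0 = 0.
    by rewrite /radius2 sqn0 mulr0 expr0n addr0 sqrtr0 add0r.
  have c1 : (fun t => radius2 (m t) (weight (x' t)) (theta (x' t))) @ F --> (0 : R).
    rewrite -[X in _ --> X](rad0 (weight x0')) -th0; apply: cvg_radius2 => //.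
    by rewrite [X in _ --> X]m00.
  have c2 : (fun t => radius2 (- m t) (weight (x' t)) (theta (x' t)) / weight (x' t))
      @ F --> (0 : R).
    rewrite -[X in _ --> X](mul0r (weight x0')^-1) -[X in X / _](rad0 (weight x0')) -th0.
    apply: cvgM; last by apply: cvgV; rewrite ?gt_eqF.
    apply: cvg_radius2 => //; rewrite -oppr0 [X in - X]m00; exact: cvgN.
  split; [rewrite z00|rewrite w00]; apply: ccvg_sqn0.
    apply: cvg_trans c1; apply: near_eq_cvg; apply: filterS zw => t /= zwt.
    by have [->] := sqn_shear h zwt.
  apply: cvg_trans c2; apply: near_eq_cvg; apply: filterS zw => t /= zwt.
  have [_ <-] := sqn_shear h zwt; rewrite mulrC mulKf//.
  by rewrite gt_eqF ?weight_gt0.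
have w00 : w0 != 0.
  by rewrite -sqn_eq0; apply: contra_neq z00 => w00; apply/eqP; rewrite -sqn_eq0 mE w00 mulr0.
have limA : ccvg F A z0.
  have -> : z0 = rescale m0 1 (weight x0') z0 (theta x0').
    by rewrite x0E -zw0 /m0 momentE rescale_id ?ltr01 ?(ltW (weight_gt0 _ _)).
  exact: cA.
have limA' : ccvg F A' w0.
  have -> : w0 = rescale (- m0) (weight x0') 1 w0 (theta x0').
    by rewrite x0E -zw0 /m0 momentN (mulrC z0) rescale_id ?weight_gt0.
  exact: cA'.
have thE : theta x0' = z0 * w0 by rewrite x0E zw0.
split.
  apply: ccvg_if; first exact: limA.
  apply: ccvg_if => //.
  have -> : z0 = theta x0' / w0 by rewrite thE mulfK.
  by apply: ccvgM => //; exact: ccvgV.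
apply: ccvg_if.
  have -> : w0 = theta x0' / z0 by rewrite thE mulrC mulKf.
  by apply: ccvgM => //; exact: ccvgV.
by apply: ccvg_if => //; exact: limA'.
Qed.

End ShearLimit.
End Shear.

Lemma pos_lower_bound (R : realType) n (J : pred 'I_n) (f : 'I_n -> R) :
  (forall i, J i -> 0 < f i) ->
  exists2 e : R, 0 < e & forall i, J i -> e ^+ 2 < f i.
Proof.
move=> f0; pose m := \big[Order.min/1]_(i | J i) f i.
have m0 : 0 < m by apply: lt_bigmin.
have m1 : m <= 1 by exact: bigmin_le_id.
(* The minimum is capped at 1, so that [m^2 / 4 < m]. *)
exists (m / 2); first by rewrite divr_gt0.
move=> i Ji; apply: (@lt_le_trans _ _ m); last exact: bigmin_le_cond.
by nra.
Qed.

(** * Shears and vertical moves as homeomorphisms of level sets *)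

Section LevelHomeos.
Variables (R : realType) (tau : R[i]) (n k : nat) (B : 'M[R]_(n, k)).
Implicit Types (p q : 'M[R]_(6, n)) (al : 'rV[R]_k) (be : 'rV[R[i]]_k).
Local Notation theta := (theta tau).
Local Notation weight := (weight tau).
Local Notation L c := (level tau B c).
Local Notation lv := (@level_val R k).

Hypothesis theta_cvg : forall (T : Type) (F : set_system T), Filter F ->
  forall (f : T -> R[i]) l, ccvg F f l -> ccvg F (fun t => theta (f t)) (theta l).

Lemma cvg_within_level c p : within (L c) (nbhs p) --> p.
Proof. exact: cvg_within. Qed.

Definition shift_beta (h : R[i]) al be : 'rV[R[i]]_k := be + h *: map_mx (real_complex R) al.

Lemma shift_betaK h al be : shift_beta (- h) al (shift_beta h al be) = be.
Proof. by rewrite /shift_beta scaleNr addrK. Qed.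

Definition shear h p : 'M[R]_(6, n) :=
  pt (fun i => shear_z tau h (zc p i) (wc p i) (xc p i))
     (fun i => shear_w tau h (zc p i) (wc p i) (xc p i))
     (fun i => shear_x tau h (zc p i) (wc p i) (xc p i)).

Lemma shear_level_map h al be : level_map tau B (lv al be) (lv al (shift_beta h al be)) (shear h).
Proof.
split.
- move=> p /levelP[eX e0 e1 e2]; apply/levelP; split.
  + by move=> i; rewrite zc_pt wc_pt xc_pt shear_on_curve.
  + rewrite -e0; congr (_ *m _); apply/rowP => i.
    by rewrite !mxE zc_pt wc_pt xc_pt moment_shear.
  + have -> : rexrow (shear h p) = rexrow p + complex.Re h *: momrow tau p.
      apply/rowP => i; rewrite !mxE xc_pt /shear_x cReD cReM /=.
      by rewrite mulr0 subr0.
    rewrite mulmxDl -scalemxAl e0 e1; apply/rowP => j; rewrite !mxE cReD cReM /=.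
    by rewrite mulr0 subr0.
  + have -> : imxrow (shear h p) = imxrow p + complex.Im h *: momrow tau p.
      apply/rowP => i; rewrite !mxE xc_pt /shear_x cImD cImM /=.
      by rewrite mulr0 add0r.
    rewrite mulmxDl -scalemxAl e0 e2; apply/rowP => j; rewrite !mxE cImD cImM /=.
    by rewrite mulr0 add0r.
- move=> p xi _; apply: pt_ext => i; rewrite !(zc_pt, wc_pt, xc_pt);
    by have [] := @shear_act _ tau (cexp 0 (2 * pi * xi 0 i))
      (cexp 0 (- (2 * pi * xi 0 i))) h (zc p i) (wc p i) (xc p i)
      (sqn_cexp0 _) (sqn_cexp0 _) (etrans (cexpM _ _ _ _) _);
      rewrite ?addr0 ?addrN ?cexp00.
- move=> p Lp; have Fp := @cvg_within_level (lv al be) p.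
  have FF : Filter (within (L (lv al be)) (nbhs p)) by exact: within_filter.
  have /levelP[eX _ _ _] := Lp.
  have near_eX i : within (L (lv al be)) (nbhs p)
      [set q | zc q i * wc q i = theta (xc q i)].
    apply: filterS (withinT _ _) => q /levelP[eq _ _ _]; exact: eq.
  have sh i := ccvg_shear theta_cvg (ccvg_zc i Fp) (ccvg_wc i Fp) (ccvg_xc i Fp)
    h (eX i) (near_eX i).
  apply: cvg_pt => i; rewrite ?zc_pt ?wc_pt ?xc_pt.
  + by have [] := sh FF FF FF FF i.
  + by have [] := sh FF FF FF FF i.
  + by apply: ccvg_shear_x; [exact: ccvg_zc|exact: ccvg_wc|exact: ccvg_xc].
Qed.

Lemma shearK h p : (forall i, zc p i * wc p i = theta (xc p i)) ->
  shear (- h) (shear h p) = p.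
Proof.
move=> eX; apply: pt_ext => i; rewrite !(zc_pt, wc_pt, xc_pt).
- by have [] := shear_zwK h (eX i).
- by have [] := shear_zwK h (eX i).
- exact: shear_xK.
Qed.

Lemma shear_level_homeo h al be : level_homeo tau B (lv al be) (lv al (shift_beta h al be)).
Proof.
exists (shear h), (shear (- h)); split.
- exact: shear_level_map.
- by rewrite -{2}(shift_betaK h al be); exact: shear_level_map.
- by move=> p /levelP[eX _ _ _]; exact: shearK.
- by move=> p /levelP[eX _ _ _]; rewrite -{1}(opprK h); exact: shearK.
Qed.

(** The row [a *m B^T] is the element of [k_R] with coordinates [a]. Every coordinate with
    [theta (x i) = 0] counts as possibly degenerate whatever its moment, so the condition involves
    [be] alone and survives any change of the real level. *)
Definition generic_complex be := forall x : 'I_n -> R[i],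
  (\row_i complex.Re (x i)) *m B = map_mx (@complex.Re R) be ->
  (\row_i complex.Im (x i)) *m B = map_mx (@complex.Im R) be ->
  forall a : 'rV[R]_k, (forall i, theta (x i) != 0 -> (a *m B^T) 0 i = 0) -> a = 0.

Definition sqz p i : R := sqn (zc p i).
Definition sqw p i : R := weight (xc p i) * sqn (wc p i).

(** The noncompact directions of the complexified torus: positive real scalings, which preserve each
    [z_i w_i] and [x_i]. *)
Definition flow (s : 'rV[R]_k) p : 'M[R]_(6, n) :=
  pt (fun i => (expR ((s *m B^T) 0 i))%:C * zc p i)
     (fun i => (expR (- (s *m B^T) 0 i))%:C * wc p i) (xc p).

Lemma sqz_ge0 p i : 0 <= sqz p i. Proof. exact: sqn_ge0. Qed.
Lemma sqw_ge0 p i : 0 <= sqw p i.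
Proof. by rewrite mulr_ge0 ?sqn_ge0// ltW ?weight_gt0. Qed.

Lemma expR_sqr (a : R) : expR a ^+ 2 = expR (2 * a).
Proof. by rewrite -expRM_natl. Qed.

Lemma sqz_flow s p i : sqz (flow s p) i = sqz p i * expR (2 * (s *m B^T) 0 i).
Proof. by rewrite /sqz zc_pt sqnM sqn_real expR_sqr mulrC. Qed.

Lemma sqw_flow s p i : sqw (flow s p) i = sqw p i * expR (- (2 * (s *m B^T) 0 i)).
Proof. by rewrite /sqw wc_pt xc_pt sqnM sqn_real expR_sqr mulrN mulrCA mulrC. Qed.

Lemma momrow_mul p : momrow tau p *m B = grad B^T (sqz p) (sqw p) 0.
Proof.
apply/rowP => j; rewrite !mxE; apply: eq_bigr => i _.
by rewrite mul0mx !mxE mulr0 oppr0 expR0 !mulr1 /moment -/(sqz p i) -/(sqw p i) (mulrC 2^-1).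
Qed.

Lemma mulmx_rowD (s t : 'rV[R]_k) i :
  ((s + t) *m B^T) 0 i = (s *m B^T) 0 i + (t *m B^T) 0 i.
Proof. by rewrite mulmxDl mxE. Qed.

Lemma grad_flow s t p :
  grad B^T (sqz (flow s p)) (sqw (flow s p)) t = grad B^T (sqz p) (sqw p) (s + t).
Proof.
apply/rowP => j; rewrite !mxE; apply: eq_bigr => i _; congr (_ / 2 * _).
by rewrite sqz_flow sqw_flow mulmx_rowD mulrDr opprD !expRD !mulrA.
Qed.

Lemma flowD s t p : flow t (flow s p) = flow (s + t) p.
Proof.
apply: pt_ext => i; rewrite !(zc_pt, wc_pt, xc_pt)// mulrA -rmorphM -expRD.
  by rewrite mulmx_rowD addrC.
by rewrite mulmx_rowD opprD addrC.
Qed.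

Lemma flow0 p : flow 0 p = p.
Proof.
by apply: pt_ext => i; rewrite !(zc_pt, wc_pt, xc_pt)// mul0mx mxE ?oppr0 expR0 mul1r.
Qed.

Section VerticalMove.
Variable be : 'rV[R[i]]_k.
Hypothesis be_generic : generic_complex be.

Definition admissible p := exists al, L (lv al be) p.

Let nondeg p i := theta (xc p i) != 0.

Let nondeg_inj p : admissible p ->
  forall a : 'rV[R]_k, (forall i, nondeg p i -> (a *m B^T) 0 i = 0) -> a = 0.
Proof. by move=> [al /levelP[eX e0 e1 e2]]; exact: be_generic. Qed.

Let nondeg_gt0 p i : admissible p -> nondeg p i -> (0 < sqz p i) && (0 < sqw p i).
Proof.
move=> [al /levelP[eX _ _ _]]; rewrite /nondeg -eX mulf_eq0 negb_or => /andP[z0 w0].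
by rewrite /sqz /sqw mulr_gt0 ?weight_gt0 ?sqn_gt0 ?z0.
Qed.

Let lower_bound p : admissible p ->
  exists2 e : R, 0 < e & forall i, nondeg p i -> e ^+ 2 < sqz p i * sqw p i.
Proof.
move=> adm; apply: pos_lower_bound => i Ji.
by have /andP[] := nondeg_gt0 adm Ji; exact: mulr_gt0.
Qed.

Lemma grad_injective p s t : admissible p ->
  grad B^T (sqz p) (sqw p) s = grad B^T (sqz p) (sqw p) t -> s = t.
Proof.
move=> adm st.
have [c c0 hc] := left_inverse_bound (nondeg_inj adm).
have [e e0 he] := lower_bound adm.
have small eta : 0 < eta -> \sum_j `|(s - t) 0 j| <= c * (n%:R * eta / 2).
  move=> eta0; apply: (grad_stable (sqz_ge0 p) (sqw_ge0 p) hc c0 e0 _ (lexx 0) _ eta0).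
  - by move=> i /he/ltW.
  - by move=> j; rewrite st subrr normr0.
  - by rewrite mul0r divr_ge0// mulr_ge0 ?ltW.
have sum0 : \sum_j `|(s - t) 0 j| <= 0.
  apply/ler_addgt0Pl => r r0; rewrite addr0.
  have [N0|Np] := eqVneq (n%:R : R) 0.
    by rewrite (le_trans (small 1 ltr01))// N0 !mul0r mulr0 ltW.
  have N0 : 0 < n%:R :> R by rewrite lt_def Np ler0n.
  apply: (le_trans (small (2 * r / (c * n%:R)) _)).
    by rewrite divr_gt0 ?mulr_gt0.
  by rewrite le_eqVlt; apply/orP; left; apply/eqP; field; rewrite Np gt_eqF.
apply/eqP; rewrite -subr_eq0; apply/eqP/rowP => j; rewrite [RHS]mxE.
apply/eqP; rewrite -normr_le0; apply: le_trans sum0.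
by rewrite (bigD1 j)//= lerDl sumr_ge0.
Qed.

Definition solution al p : 'rV[R]_k :=
  xget 0 [set s | grad B^T (sqz p) (sqw p) s = al].

Lemma solutionP al p : admissible p ->
  grad B^T (sqz p) (sqw p) (solution al p) = al.
Proof.
move=> adm; have [] : exists s, grad B^T (sqz p) (sqw p) s = al.
  apply: grad_surjective => [i|i|a ha]; [exact: sqz_ge0|exact: sqw_ge0|].
  by apply: (nondeg_inj adm) => i Ji; apply: ha; exact: nondeg_gt0.
by move=> s hs; rewrite /solution; case: xgetP => [t _ ->//|/(_ s)].
Qed.

Lemma cvg_solution al al' p j : L (lv al be) p ->
  (fun q => solution al' q 0 j) @ within (L (lv al be)) (nbhs p) --> solution al' p 0 j.
Proof.
move=> Lp; have adm : admissible p by exists al.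
have Fp := @cvg_within_level (lv al be) p.
set F := within _ _ in Fp *; have FF : Filter F by exact: within_filter.
have [c c0 hc] := left_inverse_bound (nondeg_inj adm).
have [e e0 he] := lower_bound adm.
pose s0 := solution al' p.
have cz i : (fun q => sqz q i) @ F --> sqz p i by apply: cvg_sqn; exact: ccvg_zc.
have cw i : (fun q => sqw q i) @ F --> sqw p i.
  apply: cvgM; last by apply: cvg_sqn; exact: ccvg_wc.
  by apply: cvg_weight; exact: ccvg_xc.
have near_e : F [set q | forall i, nondeg p i -> e ^+ 2 <= sqz q i * sqw q i].
  apply: (@filter_forall _ _ _ F FF) => i; have [Ji|Ji] := boolP (nondeg p i); last first.
    by apply: filterS filterT => q _.
  have cm : (fun q => sqz q i * sqw q i) @ F --> sqz p i * sqw p i by exact: cvgM.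
  by apply: (@filterS _ F FF _ _ _ (@cvgr_ge _ _ F FF _ _ cm _ (he i Ji))) => q.
have near_adm : F [set q | admissible q].
  by apply: filterS (withinT _ _) => q Lq; exists al.
apply/cvgrPdist_le => r r0.
pose eta := 2 * r / (c * n.+1%:R).
have eta0 : 0 < eta by rewrite divr_gt0 ?mulr_gt0.
pose eps := eta * e / 2 / c.
have eps0 : 0 < eps by rewrite !divr_gt0// mulr_gt0.
have near_grad : F [set q | forall i, `|al' 0 i - grad B^T (sqz q) (sqw q) s0 0 i| <= eps].
  apply: (@filter_forall _ _ _ F FF) => i.
  have : (fun q => grad B^T (sqz q) (sqw q) s0 0 i) @ F --> al' 0 i.
    rewrite -(solutionP al' adm) -/s0 [X in _ --> X]mxE.
    under eq_fun do rewrite mxE.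
    apply: cvg_sumR => l _; apply: cvgM; last exact: cvg_cst.
    apply: cvgM; last exact: cvg_cst.
    by apply: cvgB; apply: cvgM => //; exact: cvg_cst.
  by move=> /cvgrPdist_le/(_ eps eps0).
apply: filterS3 near_e near_adm near_grad => q qe qadm qgrad /=.
have : \sum_i `|(solution al' q - s0) 0 i| <= c * (n%:R * eta / 2).
  apply: (grad_stable (sqz_ge0 q) (sqw_ge0 q) hc c0 e0 qe (ltW eps0) _ eta0).
    by move=> i; rewrite solutionP.
  by rewrite /eps divfK// gt_eqF.
move=> h; apply: (@le_trans _ _ (\sum_i `|(solution al' q - s0) 0 i|)).
  rewrite (bigD1 j)//= -[leLHS]addr0 lerD ?sumr_ge0//.
  by rewrite distrC !mxE.
apply: (le_trans h); rewrite /eta.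
have -> : c * (n%:R * (2 * r / (c * n.+1%:R)) / 2) = r * (n%:R / n.+1%:R).
  by have : 0 < n.+1%:R :> R by []; move: n.+1%:R => N N0; field; rewrite !gt_eqF.
by rewrite ger_pMr// ler_pdivrMr// mul1r ler_nat.
Qed.

Definition vertical al p := flow (solution al p) p.

Lemma vertical_level_map al al' :
  level_map tau B (lv al be) (lv al' be) (vertical al').
Proof.
split.
- move=> p Lp; have adm : admissible p by exists al.
  have /levelP[eX e0 e1 e2] := Lp; apply/levelP; split.
  + move=> i; rewrite zc_pt wc_pt xc_pt mulrACA -rmorphM -expRD addrN expR0 mul1r.
    exact: eX.
  + by rewrite momrow_mul grad_flow addr0 solutionP.
  + by rewrite -e1; congr (_ *m _); apply/rowP => i; rewrite !mxE xc_pt.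
  + by rewrite -e2; congr (_ *m _); apply/rowP => i; rewrite !mxE xc_pt.
- move=> p xi Lp.
  have zE : sqz (actK xi p) = sqz p.
    by apply: funext => i; rewrite /sqz zc_pt sqnM sqn_cexp0 mul1r.
  have wE : sqw (actK xi p) = sqw p.
    by apply: funext => i; rewrite /sqw wc_pt xc_pt sqnM sqn_cexp0 mul1r.
  rewrite /vertical /solution zE wE.
  by apply: pt_ext => i; rewrite !(zc_pt, wc_pt, xc_pt)// mulrCA.
- move=> p Lp; have Fp := @cvg_within_level (lv al be) p.
  have FF : Filter (within (L (lv al be)) (nbhs p)) by exact: within_filter.
  have cs i := @cvg_mulmxr R n k B^T _ _ FF _ _ i (fun j => @cvg_solution al al' p j Lp).
  apply: cvg_pt => i; rewrite ?zc_pt ?wc_pt ?xc_pt.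
  + by apply: ccvgM; [apply: ccvg_real; exact: cvg_expR|exact: ccvg_zc].
  + apply: ccvgM; last exact: ccvg_wc.
    by apply: ccvg_real; apply: cvg_expR; exact: cvgN.
  + exact: ccvg_xc.
Qed.

Lemma verticalK al al' p : L (lv al be) p -> vertical al (vertical al' p) = p.
Proof.
move=> Lp; have adm : admissible p by exists al.
have [h _ _] := vertical_level_map al al'.
have adm' : admissible (vertical al' p) by exists al'; exact: h.
have := solutionP al adm'; rewrite {1 2}/vertical grad_flow.
have /levelP[_ e0 _ _] := Lp.
rewrite -[RHS]e0 momrow_mul => /(grad_injective adm) e.
by rewrite {1}/vertical flowD e flow0.
Qed.

Lemma vertical_level_homeo al al' : level_homeo tau B (lv al be) (lv al' be).
Proof.
exists (vertical al'), (vertical al); split; try exact: vertical_level_map.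
- by move=> p; exact: verticalK.
- by move=> p; exact: verticalK.
Qed.

End VerticalMove.
End LevelHomeos.

Section Genericity.
Variables (R : realType) (tau : R[i]) (n d k : nat) (u : 'M[int]_(n, d)).
Variable B : 'M[R]_(n, k).
Implicit Types (p q : 'M[R]_(6, n)) (al : 'rV[R]_k) (be : 'rV[R[i]]_k).
Hypothesis htau : 0 < complex.Im tau.
Local Notation theta := (theta tau).
Local Notation weight := (weight tau).
Local Notation L c := (level tau B c).
Local Notation lv := (@level_val R k).

Lemma weight_le1 x : weight x <= 1.
Proof.
rewrite -[leRHS](@expR0 R) ler_expR !mulNr oppr_le0 divr_ge0 ?(ltW htau)//.
by rewrite mulr_ge0 ?sqr_ge0// mulr_ge0 ?pi_ge0.
Qed.

(* Only the real moment map matters: at a point with [z_i = w_i = 0] the i-th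
   summand of [mu_R] vanishes to second order. *)
Lemma regular_nondegenerate c p (a : 'rV[R]_k) : regular_value tau B c -> L c p ->
  (forall i, ~ (zc p i = 0 /\ wc p i = 0) -> (a *m B^T) 0 i = 0) -> a = 0.
Proof.
move=> reg Lp ha; have [_ [dmu sur]] := reg p Lp.
pose v : 'M[R]_(3, k) := \matrix_(r, j) if r == 0 then a 0 j else 0.
have [h [_ dh]] := sur v.
pose G q := \sum_j a 0 j * muK tau B q 0 j.
have GE q : G q = 2^-1 * \sum_i (sqn (zc q i) - weight (xc q i) * sqn (wc q i)) * (a *m B^T) 0 i.
  rewrite /G mulr_sumr; under eq_bigr do rewrite mxE /= mulr_sumr mulr_sumr.
  rewrite exchange_big; apply: eq_bigr => i _ /=.
  rewrite [(a *m B^T) 0 i]mxE !mulr_sumr; apply: eq_bigr => j _.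
  by rewrite mxE /weight; ring.
pose M := \sum_i (sqn (zc h i) + sqn (wc h i)) * `|(a *m B^T) 0 i|.
have zcE t i : zc (t *: h + p) i = t%:C * zc h i + zc p i.
  by apply/eqP; rewrite eq_complex /= !mxE; apply/andP; split; apply/eqP; ring.
have wcE t i : wc (t *: h + p) i = t%:C * wc h i + wc p i.
  by apply/eqP; rewrite eq_complex /= !mxE; apply/andP; split; apply/eqP; ring.
have GM t : `|G (t *: h + p)| <= t ^+ 2 * M.
  rewrite GE normrM ger0_norm ?invr_ge0//.
  apply: (@le_trans _ _ (1 * (t ^+ 2 * M))); last by rewrite mul1r.
  apply: ler_pM; rewrite ?invr_ge0//; first by rewrite invf_le1// ler1n.
  apply: (le_trans (ler_norm_sum _ _ _)); rewrite /M mulr_sumr; apply: ler_sum => i _.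
  rewrite normrM mulrA.
  have [[z0 w0]|nd] := pselect (zc p i = 0 /\ wc p i = 0); last first.
    by rewrite ha// normr0 !mulr0.
  rewrite ler_wpM2r// zcE wcE z0 w0 !addr0 !sqnM !sqn_real.
  set z2 := t ^+ 2 * sqn (zc h i); set w2 := t ^+ 2 * sqn (wc h i).
  have z20 : 0 <= z2 by rewrite mulr_ge0 ?sqr_ge0 ?sqn_ge0.
  have w20 : 0 <= w2 by rewrite mulr_ge0 ?sqr_ge0 ?sqn_ge0.
  apply: (le_trans (ler_normB _ _)); rewrite mulrDr -/z2 -/w2 ger0_norm// lerD2l.
  rewrite ger0_norm ?ler_piMl ?weight_le1// mulr_ge0//.
  by rewrite ltW ?weight_gt0.
have Gp : G p = 0.
  apply/eqP; rewrite -normr_le0; have := GM 0.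
  by rewrite scale0r add0r expr0n mul0r.
have lim1 : (fun t : R => t^-1 * G (t *: h + p)) @ 0^' --> (0 : R).
  apply/norm_cvg0P.
  apply: (@squeeze_cvgr _ _ _ _ (cst 0) (fun t => `|t| * M)); last 2 first.
  - exact: cvg_cst.
  - rewrite -[X in _ --> X](mul0r M); apply: cvgM; last exact: cvg_cst.
    by rewrite -[X in _ --> X](@normr0 _ R); apply: cvg_norm; exact: cvg_within.
  near=> t; rewrite normr_ge0 /= normrM normfV.
  have t0 : t != 0 by near: t; exact: nbhs_dnbhs_neq.
  rewrite ler_pdivrMl ?normr_gt0// mulrA -expr2 real_normK ?num_real//.
have cvgD : (fun t : R => t^-1 *: (muK tau B (t *: h + p) - muK tau B p)) @ 0^' --> v.
  rewrite -dh -deriveE//; exact: (diff_derivable dmu).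
have lim2 : (fun t : R => t^-1 * G (t *: h + p)) @ 0^' --> \sum_j a 0 j * a 0 j.
  have -> : (fun t : R => t^-1 * G (t *: h + p)) = (fun t : R =>
      \sum_j a 0 j * (t^-1 *: (muK tau B (t *: h + p) - muK tau B p)) 0 j).
    apply: funext => t; have -> : G (t *: h + p) = G (t *: h + p) - G p by rewrite Gp subr0.
    rewrite /G -sumrB mulr_sumr.
    apply: eq_bigr => j _; rewrite [in RHS]mxE [in RHS]mxE [(- muK _ _ _) _ _]mxE.
    by ring.
  apply: cvg_sumR => j _; apply: cvgM; first exact: cvg_cst.
  have -> : a 0 j = v 0 j by rewrite mxE.
  exact: (cvg_comp _ _ cvgD (@coord_continuous _ _ _ 0 j v)).
have /eqP : \sum_j a 0 j * a 0 j = 0.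
  by rewrite -(cvg_lim _ lim2)// (cvg_lim _ lim1).
rewrite psumr_eq0 => [/allP s0|j _]; last by rewrite -expr2 sqr_ge0.
apply/rowP => j; rewrite [RHS]mxE; have := s0 j (mem_index_enum _).
by rewrite /= mulf_eq0 orbb => /eqP.
Unshelve. all: by end_near. Qed.

Lemma exists_fiber (m : R) (x : R[i]) :
  exists z w, z * w = theta x /\ moment tau z w x = m.
Proof.
have wp := weight_gt0 tau x.
pose r := radius2 m (weight x) (theta x).
have rmul := radius2_mul m (theta x) (ltW wp).
have [r0|r0] := ltP 0 r.
  pose z : R[i] := (Num.sqrt r)%:C.
  have sz : sqn z = r by rewrite sqn_real sqr_sqrtr ?ltW.
  have z0 : z != 0 by rewrite -sqn_gt0 sz.
  exists z, (theta x / z); split; first by rewrite mulrC divfK.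
  rewrite /moment sqnM sqn_V// sz mulrA -rmul -/r (mulrAC r) divff ?gt_eqF// mul1r.
  by rewrite radius2_sub mulrA mulVf ?mul1r.
have {}r0 : r = 0 by apply/eqP; rewrite eq_le r0 radius2_ge0 ?ltW.
have th0 : theta x = 0.
  apply/eqP; rewrite -sqn_eq0; move/eqP: rmul; rewrite -/r r0 mul0r eq_sym mulf_eq0.
  by rewrite (gt_eqF wp).
have m0 : m <= 0.
  by rewrite leNgt; apply/negP => /(radius2_gt0 (weight x) (theta x)); rewrite -/r r0 ltxx.
exists 0, (Num.sqrt (- (2 * m) / weight x))%:C; rewrite mul0r; split=> //.
rewrite /moment sqn0 sqn_real sqr_sqrtr; last first.
  by rewrite divr_ge0 ?(ltW wp)// oppr_ge0 pmulr_rle0.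
by field; rewrite gt_eqF.
Qed.

Lemma exists_point (m x y : 'rV[R]_n) : exists p,
  [/\ forall i, zc p i * wc p i = theta (xc p i), momrow tau p = m,
      rexrow p = x & imxrow p = y].
Proof.
have /choice[zw hzw] : forall i, exists zw : R[i] * R[i],
    zw.1 * zw.2 = theta (x 0 i +i* y 0 i) /\ moment tau zw.1 zw.2 (x 0 i +i* y 0 i) = m 0 i.
  by move=> i; have [z [w ?]] := exists_fiber (m 0 i) (x 0 i +i* y 0 i); exists (z, w).
exists (pt (fun i => (zw i).1) (fun i => (zw i).2) (fun i => x 0 i +i* y 0 i)).
split.
- by move=> i; rewrite zc_pt wc_pt xc_pt; have [] := hzw i.
- by apply/rowP => i; rewrite mxE zc_pt wc_pt xc_pt; have [] := hzw i.
- by apply/rowP => i; rewrite mxE xc_pt.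
- by apply/rowP => i; rewrite mxE xc_pt.
Qed.

Lemma moment_degenerate z w x : z * w = 0 -> moment tau z w x = 0 -> z = 0 /\ w = 0.
Proof.
move=> zw m0; have wp := weight_gt0 tau x.
have mE : sqn z = weight x * sqn w by move: m0; rewrite /moment; lra.
move/eqP: zw; rewrite mulf_eq0 => /orP[]/eqP e0; move/eqP: mE; rewrite e0 sqn0.
  by rewrite eq_sym mulf_eq0 (gt_eqF wp) sqn_eq0 /= => /eqP.
by rewrite mulr0 sqn_eq0 => /eqP.
Qed.

Definition generic_level al be := forall p, L (lv al be) p -> forall a : 'rV[R]_k,
  (forall i, ~ (zc p i = 0 /\ wc p i = 0) -> (a *m B^T) 0 i = 0) -> a = 0.

Lemma theta_code x : exists o : option (int * int),
  if o is Some (m, l) then theta x = 0 /\ x = m%:~R + l%:~R * tau else theta x != 0.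
Proof.
have [t0|t0] := eqVneq (theta x) 0; last by exists None.
by have [m [l e]] := theta_eq0 htau t0; exists (Some (m, l)).
Qed.

(* Two bad values of [h] with the same degenerate coordinates would produce a
   point of the level set at which genericity fails. *)
Lemma exists_generic_shift al be : generic_level al be ->
  exists h, generic_complex tau B (shift_beta h al be).
Proof.
move=> gen.
pose P (e : {ffun 'I_n -> option (int * int)}) (t : R) := exists x : 'I_n -> R[i],
  [/\ (\row_i complex.Re (x i)) *m B = map_mx (@complex.Re R) be + t *: al,
      (\row_i complex.Im (x i)) *m B = map_mx (@complex.Im R) be,
      exists2 a : 'rV[R]_k, a != 0 & forall i, theta (x i) != 0 -> (a *m B^T) 0 i = 0 &
      forall i, if e i is Some (m, l) then theta (x i) = 0 /\ x i = m%:~R + l%:~R * tau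
                else theta (x i) != 0].
have Puniq e t1 t2 : P e t1 -> P e t2 -> t1 = t2.
  move=> [x1 [r1 i1 [a a0 ha] c1]] [x2 [r2 i2 _ c2]]; apply/eqP/negPn/negP => t12.
  have dt : t1 - t2 != 0 by rewrite subr_eq0.
  pose m : 'rV[R]_n := (t1 - t2)^-1 *: (\row_i complex.Re (x1 i) - \row_i complex.Re (x2 i)).
  have mB : m *m B = al.
    rewrite -scalemxAl mulmxBl r1 r2 opprD addrACA subrr add0r -scalerBl scalerA.
    by rewrite mulVf// scale1r.
  have [p [eX pm px py]] := exists_point m (\row_i complex.Re (x1 i) - t1 *: m)
    (\row_i complex.Im (x1 i)).
  have Lp : L (lv al be) p.
    apply/levelP; split=> //; first by rewrite pm.
      by rewrite px mulmxBl r1 -scalemxAl mB addrK.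
    by rewrite py.
  move/eqP: a0; apply; apply: (gen p Lp) => i nd; apply: ha; apply/eqP => th0; apply: nd.
  have x12 : x1 i = x2 i.
    by have := c1 i; have := c2 i; case: (e i) => [[m' l] [_ ->] [_ ->]|_]//; rewrite th0 eqxx.
  have m0 : m 0 i = 0 by rewrite !mxE x12 subrr mulr0.
  have xp : xc p i = x1 i.
    have /rowP/(_ i) := px; have /rowP/(_ i) := py.
    rewrite !mxE -x12 subrr !mulr0 subr0; case: (xc p i) => ? ? /= -> ->.
    by case: (x1 i).
  apply: (@moment_degenerate _ _ (xc p i)); first by rewrite eX xp.
  by have /rowP/(_ i) := pm; rewrite mxE => ->.
have [t ht] : exists t : R, forall e, ~ P e t.
  apply: (@countable_avoid R {ffun 'I_n -> option (int * int)}) => e.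
  have [[t Pt]|nP] := pselect (exists t, P e t).
    rewrite (_ : P e = [set t]); first exact: countable1.
    by apply/seteqP; split=> [s Ps|s ->//]; exact: Puniq Ps Pt.
  rewrite (_ : P e = set0); first exact: countable0.
  by apply/seteqP; split=> [s Ps|//]; apply: nP; exists s.
exists t%:C => x xr xi a ha; apply/eqP/negPn/negP => a0.
have /choice[cd hcd] := fun i => theta_code (x i).
apply: (ht [ffun i => cd i]); exists x; split.
- rewrite xr; apply/rowP => j; rewrite !mxE cReD cReM /= mul0r subr0.
  by [].
- rewrite xi; apply/rowP => j; rewrite !mxE cImD cImM /= mulr0 mul0r !addr0.
  by [].
- by exists a.
- by move=> i; rewrite ffunE; exact: hcd.
Qed.

Lemma exists_generic_imaginary : exists y : 'rV[R]_k, forall be,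
  map_mx (@complex.Im R) be = y -> generic_complex tau B be.
Proof.
pose y (t : R) : 'rV[R]_k := \row_j t ^+ j.+1.
pose val (o : option (int * int)) : R := if o is Some (_, l) then l%:~R * complex.Im tau else 0.
pose Q (e : {ffun 'I_n -> option (int * int)}) (t : R) := exists X : 'rV[R]_n,
  [/\ X *m B = y t,
      exists2 a : 'rV[R]_k, a != 0 & forall i, e i = None -> (a *m B^T) 0 i = 0 &
      forall i, e i -> X 0 i = val (e i)].
have [t ht] : exists t : R, forall e, ~ Q e t.
  apply: (@countable_avoid R {ffun 'I_n -> option (int * int)}) => e.
  have [[a [a0 ha]]|na] := pselect (exists a : 'rV[R]_k, a != 0 /\
      forall i, e i = None -> (a *m B^T) 0 i = 0); last first.
    rewrite (_ : Q e = set0); first exact: countable0.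
    by apply/seteqP; split=> [s [X [_ [a a0 ha] _]]|//]; apply: na; exists a.
  pose K := \sum_i val (e i) * (a *m B^T) 0 i.
  pose f : {poly R} := \sum_(j < k) a 0 j *: 'X^(j.+1) - K%:P.
  have f0 : f != 0.
    apply: contraNneq a0 => f0; apply/eqP/rowP => j; rewrite [RHS]mxE.
    have : f`_(j.+1) = 0 by rewrite f0 coef0.
    rewrite coefB coef_sum coefC /= subr0 (bigD1 j)//= big1 ?addr0 => [|l lj].
      by rewrite coefZ coefXn eqxx mulr1.
    rewrite coefZ coefXn eqSS eq_sym (inj_eq val_inj) (negPf lj) mulr0 //.
  apply: (@sub_countable _ _ _ [set t | root f t]); last exact: countable_root.
  apply: subset_card_le => t [X [XB _ hX]] /=.
  rewrite /root /f hornerD hornerN hornerC horner_sum subr_eq0; apply/eqP.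
  transitivity (\sum_j a 0 j * (X *m B) 0 j).
    by apply: eq_bigr => j _; rewrite hornerZ hornerXn XB mxE.
  under eq_bigr do rewrite mxE mulr_sumr.
  rewrite exchange_big; apply: eq_bigr => i _ /=.
  transitivity (X 0 i * (a *m B^T) 0 i).
    by rewrite [(a *m B^T) 0 i]mxE mulr_sumr; apply: eq_bigr => j _; rewrite mxE; ring.
  case ei : (e i) => [ml|]; first by rewrite hX ?ei.
  by rewrite ha ?ei// !mulr0.
exists (y t) => be bey x xr xi a ha; apply/eqP/negPn/negP => a0.
have /choice[cd hcd] := fun i => theta_code (x i).
apply: (ht [ffun i => cd i]); exists (\row_i complex.Im (x i)); split.
- by rewrite xi.
- exists a => // i; rewrite ffunE => oi; apply: ha.
  by have := hcd i; rewrite oi.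
- move=> i; rewrite ffunE mxE; have := hcd i; case: (cd i) => [[m l] [_ ->] _|//].
  rewrite cImD cImM -!(rmorph_int (real_complex R)) /=.
  by rewrite add0r mul0r addr0.
Qed.

End Genericity.

Section Chain.
Variables (R : realType) (tau : R[i]) (n d : nat) (u : 'M[int]_(n, d)).
Variable B : 'M[R]_(n, n - d).
Hypothesis htau : 0 < complex.Im tau.
Hypothesis hprim : forall i, primitive_row u i.
Hypothesis hB : kernel_basis u B.
Local Notation theta := (theta tau).
Local Notation lv := (@level_val R (n - d)).

Lemma solve_row (b : 'rV[R]_(n - d)) i (t : R) :
  exists x : 'rV[R]_n, x *m B = b /\ x 0 i = t.
Proof.
have [uB [rB _]] := hB.
have /row_fullP[L LB] : row_full B by rewrite /row_full rB.
have [j uij] : exists j, u i j != 0.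
  apply: contrapT => nu; have [] := @hprim i 0 => // j.
  by rewrite dvd0z; apply/negPn/negP => uij; apply: nu; exists j.
pose v := row j (map_mx (fun m : int => (m%:~R : R)) u)^T.
have vB : v *m B = 0 by rewrite -row_mul uB row0.
have vi : v 0 i != 0 by rewrite !mxE intr_eq0.
pose x0 := b *m L.
exists (x0 + ((t - x0 0 i) / v 0 i) *: v); split.
  by rewrite mulmxDl -scalemxAl vB scaler0 addr0 -mulmxA LB mulmx1.
by rewrite mxE [X in _ + X]mxE divfK// addrC subrK.
Qed.

Lemma eqX_Re (p : 'M[R]_(6, n)) i : eqX tau p 0 i =
  complex.Re (zc p i * wc p i) - complex.Re (theta (xc p i)).
Proof. by rewrite mxE -cReB. Qed.

Lemma eqX_Im (p : 'M[R]_(6, n)) i : eqX tau p 1 i =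
  complex.Im (zc p i * wc p i) - complex.Im (theta (xc p i)).
Proof. by rewrite mxE -cImB. Qed.

(* Since [u_i <> 0], every complex number occurs as [x_i] on the level set, so
   the differentiability contained in regularity makes [theta] continuous. *)
Lemma theta_cvg_of_regular (i : 'I_n) al be : regular_value tau B (lv al be) ->
  forall (T : Type) (F : set_system T), Filter F ->
  forall (f : T -> R[i]) l, ccvg F f l -> ccvg F (fun t => theta (f t)) (theta l).
Proof.
move=> reg T F FF f l fl.
have [m [mB _]] := solve_row al i 0.
have [x [xB xi]] := solve_row (map_mx (@complex.Re R) be) i (complex.Re l).
have [y [yB yi]] := solve_row (map_mx (@complex.Im R) be) i (complex.Im l).
have [p [eX pm px py]] := exists_point tau m x y.
have Lp : level tau B (lv al be) p by apply/levelP; rewrite pm px py.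
have [de _] := reg p Lp.
have pl : xc p i = l.
  have /rowP/(_ i) := px; have /rowP/(_ i) := py; rewrite !mxE xi yi.
  by case: (xc p i) (l) => ? ? [? ?] /= -> ->.
pose P t := pt (zc p) (wc p) (fun i' => if i' == i then f t else xc p i').
have cP : P @ F --> p.
  apply: cvg_pt => i'; [exact: ccvg_cst|exact: ccvg_cst|].
  by have [->|_] := eqVneq i' i; [rewrite pl|exact: ccvg_cst].
have cE r : (fun t => eqX tau (P t) r i) @ F --> eqX tau p r i.
  have := differentiable_continuous de => /(cvg_comp _ _ cP) h.
  exact: (cvg_comp _ _ h (@coord_continuous _ _ _ r i _)).
split.
  have -> : (fun t => complex.Re (theta (f t))) =
      (fun t => complex.Re (zc p i * wc p i) - eqX tau (P t) 0 i).
    by apply: funext => t; rewrite eqX_Re zc_pt wc_pt xc_pt eqxx subKr.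
  have -> : complex.Re (theta l) = complex.Re (zc p i * wc p i) - eqX tau p 0 i.
    by rewrite eqX_Re pl subKr.
  by apply: cvgB => //; exact: cvg_cst.
have -> : (fun t => complex.Im (theta (f t))) =
    (fun t => complex.Im (zc p i * wc p i) - eqX tau (P t) 1 i).
  by apply: funext => t; rewrite eqX_Im zc_pt wc_pt xc_pt eqxx subKr.
have -> : complex.Im (theta l) = complex.Im (zc p i * wc p i) - eqX tau p 1 i.
  by rewrite eqX_Im pl subKr.
by apply: cvgB => //; exact: cvg_cst.
Qed.

Hypothesis theta_cvg : forall (T : Type) (F : set_system T), Filter F ->
  forall (f : T -> R[i]) l, ccvg F f l -> ccvg F (fun t => theta (f t)) (theta l).

Lemma generic_level_homeo_normal (y : 'rV[R]_(n - d)) al be :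
  (forall be', map_mx (@complex.Im R) be' = y -> generic_complex tau B be') ->
  generic_level tau B al be ->
  level_homeo tau B (lv al be) (lv 0 (map_mx (fun t => 0 +i* t) y)).
Proof.
move=> hy gen; have [h gh] := exists_generic_shift htau gen.
have ImE h' (al' : 'rV[R]_(n - d)) be' : map_mx (@complex.Im R) (shift_beta h' al' be') =
    map_mx (@complex.Im R) be' + complex.Im h' *: al'.
  by apply/rowP => j; rewrite !mxE cImD cImM /= mulr0 add0r.
have ReE (b' : 'rV[R[i]]_(n - d)) : shift_beta 1 (- map_mx (@complex.Re R) b') b' =
    map_mx (fun t => 0 +i* t) (map_mx (@complex.Im R) b').
  apply/rowP => j; rewrite !mxE mul1r; case: (b' 0 j) => s t.
  by apply/eqP; rewrite eq_complex /= addrN addr0 !eqxx.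
set b := shift_beta h al be in gh.
apply: (level_homeo_trans (shear_level_homeo B theta_cvg h al be)); rewrite -/b.
pose a1 := y - map_mx (@complex.Im R) b.
apply: (level_homeo_trans (vertical_level_homeo gh al a1)).
apply: (level_homeo_trans (shear_level_homeo B theta_cvg 'i%C a1 b)).
set b1 := shift_beta _ a1 b.
have b1y : map_mx (@complex.Im R) b1 = y by rewrite ImE /= scale1r addrC subrK.
pose a2 := - map_mx (@complex.Re R) b1.
apply: (level_homeo_trans (vertical_level_homeo (hy _ b1y) a1 a2)).
apply: (level_homeo_trans (shear_level_homeo B theta_cvg 1 a2 b1)).
rewrite /a2 ReE b1y.
apply: vertical_level_homeo; apply: hy.
by apply/rowP => j; rewrite !mxE.
Qed.

End Chain.

Theorem theorem3p7 (R : realType) (tau : R[i]) (htau : 0 < complex.Im tau)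
  (n d : nat) (u : 'M[int]_(n, d))
  (hprim : forall i, primitive_row u i) (hspan : spans_lattice u)
  (B : 'M[R]_(n, n - d)) (hB : kernel_basis u B)
  (alpha alpha' : 'rV[R]_(n - d)) (beta beta' : 'rV[R[i]]_(n - d))
  (hreg : regular_value tau B (level_val alpha beta))
  (hreg' : regular_value tau B (level_val alpha' beta')) :
  quot_homeomorphic tau u B (level_val alpha beta) (level_val alpha' beta').
Proof.
apply: quot_homeomorphic_of_level_homeo.
case: n u hprim hspan B hB alpha alpha' beta beta' hreg hreg'
  => [|n'] u' hprim' _ B' hB' al al' be be' reg reg'.
  have -> : level_val al be = level_val al' be' by apply/matrixP => r [].
  exists id, id; split=> //; split=> // p _; exact: cvg_within.
have tc := theta_cvg_of_regular hprim' hB' ord0 reg.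
have [y hy] := exists_generic_imaginary B' htau.
have norm al1 be1 : regular_value tau B' (level_val al1 be1) ->
    level_homeo tau B' (level_val al1 be1) (level_val 0 (map_mx (fun t => 0 +i* t) y)).
  move=> reg1; apply: (generic_level_homeo_normal htau tc hy) => p Lp a.
  exact: (regular_nondegenerate htau reg1 Lp).
exact: level_homeo_trans (norm _ _ reg) (level_homeo_sym (norm _ _ reg')).
Qed.
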